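(* Let $(X,\mathcal{B},\mu)$ be a finite measure space and let $T_1,\dots,T_6$ be six measure preserving transformations of $(X,\mathcal{B},\mu)$ (not necessarily commuting). Let $f_1,\dots,f_6$ be bounded measurable functions on $X$. Then the averages $$\frac{1}{N^3}\sum_{n,m,p=1}^{N} f_1(T_1^n x)\,f_2(T_2^m x)\,f_3(T_3^p x)\,f_4(T_4^{n+m}x)\,f_5(T_5^{n+p}x)\,f_6(T_6^{m+p}x)$$ converge for $\mu$-almost every $x\in X$ and in norm as $N\to\infty$.
   Context: ''In norm'' means in the norm of $L^2(\mu)$. The transformations $T_i$ all act on the same finite measure space and no commutation relation between them is assumed. *)

(* Defs.v *)
From HB Require Import structures.
From mathcomp Require Import all_boot all_order all_algebra.
From mathcomp Require Import complex.
From mathcomp Require Import all_classical all_reals all_analysis.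
Set Implicit Arguments.
Unset Strict Implicit.
Unset Printing Implicit Defensive.
Import Order.TTheory GRing.Theory Num.Theory.
Import numFieldNormedType.Exports.

Local Open Scope classical_set_scope.
Local Open Scope ring_scope.

(* The scalars are R[i]^o, i.e. the complex numbers R[i] seen as a normed space
   over themselves: this is how R[i] gets its topology from the library. *)

Definition measure_preserving d (X : measurableType d) (R : realType)
    (mu : {measure set X -> \bar R}) (T : X -> X) : Prop :=
  measurable_fun setT T /\
  forall A : set X, measurable A -> mu (T @^-1` A) = mu A.

(* R[i] has no measurable structure in the library; Borel measurability of a
   complex-valued function is that of its real and imaginary parts. *)
Definition complex_measurable d (X : measurableType d) (R : realType)
    (f : X -> R[i]^o) : Prop :=
  measurable_fun setT (fun x => complex.Re (f x)) /\
  measurable_fun setT (fun x => complex.Im (f x)).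

(* Normc.normc is the modulus with values in R, whereas `|z| lies in R[i]. *)
Definition L2norm d (X : measurableType d) (R : realType)
    (mu : {measure set X -> \bar R}) (f : X -> R[i]^o) : \bar R :=
  ('N[mu]_2%:E[EFin \o (fun x => Normc.normc (f x))])%E.

Definition cvg_in_L2 d (X : measurableType d) (R : realType)
    (mu : {measure set X -> \bar R}) (A : nat -> X -> R[i]^o) : Prop :=
  exists g : X -> R[i]^o,
    [/\ complex_measurable g,
        (L2norm mu g < +oo)%E &
        L2norm mu (fun x => A N x - g x) @[N --> \oo] --> 0%E].

Definition cube_average (X : Type) (R : realType)
    (T1 T2 T3 T4 T5 T6 : X -> X) (f1 f2 f3 f4 f5 f6 : X -> R[i]^o)
    (N : nat) (x : X) : R[i]^o :=
  (N%:R ^+ 3)^-1 *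
  \sum_(1 <= n < N.+1) \sum_(1 <= m < N.+1) \sum_(1 <= p < N.+1)
    (f1 (iter n T1 x) * f2 (iter m T2 x) * f3 (iter p T3 x) *
     f4 (iter (n + m) T4 x) * f5 (iter (n + p) T5 x) *
     f6 (iter (m + p) T6 x)).

(* Main.v *)
Require Import Defs.
From HB Require Import structures.
From mathcomp Require Import all_boot all_order all_algebra.
From mathcomp Require Import cyclic separable cyclotomic complex.
From mathcomp Require Import all_classical all_reals all_analysis measurable_realfun.
From mathcomp Require Import ring lra zify.
Import Order.TTheory GRing.Theory Num.Theory.
Import numFieldNormedType.Exports.
Local Open Scope classical_set_scope.
Local Open Scope ring_scope.
Set Implicit Arguments.
Unset Strict Implicit.
Unset Printing Implicit Defensive.

(**
For a point x put a_n = f (T^n x). The proof combines a deterministic statement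
about sequences with a uniform Wiener-Wintner theorem valid without ergodicity.

Deterministic part. Call a sequence a Wiener-Wintner sequence if for every e > 0
there is a finite sum s of terms c l^n, |l| = 1, such that
|sum_(n < N) z^n (a_n - s_n)| <= N e for all large N and all |z| = 1. On the
2N-th roots of unity, sum_(n, m < N) a_n b_m r_(n+m) is the scalar product of the
transform of r with the product of the transforms of a and b; by Parseval it is
small as soon as the transform of r is uniformly small. Hence each of f4, f5, f6
may be replaced by a finite sum of exponentials, and for exponentials the triple
average splits into a product of three twisted averages in n, m and p, which
converge.

Dynamical part. Let P_j(x, t) be the limsup over N of the mean over n < N of
|2^-j sum_(h < 2^j) e^(iht) a_(n+h)|^2. It decreases with j, is Lipschitz in t and
T-invariant in x. If some P_j(x, .) is everywhere < e^2, van der Corput's inequality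
bounds all the twisted averages of a. Otherwise there is an angle t(x), measurable
and T-invariant in x, with P_j(x, t(x)) >= e^2 for all j. By the maximal
ergodic theorem the averages u_j = 2^-j sum_(h < 2^j) e^(iht) f o T^h satisfy
||u_j||^2 >= e^2/2 mu(E), where E is the set of the bad points; they converge in L^2 to a
function c with c o T = e^(-it) c, and subtracting c from f lowers ||f||^2 by at
least e^2/2 mu(E). After finitely many subtractions mu(E) is as small as desired.
Letting the angle depend on x replaces the ergodic decomposition.
*)

Local Notation normc := Normc.normc.

(** * Complex numbers and limits *)

Section ComplexModulus.
Variable R : realType.
Implicit Types (z w : R[i]) (x : R).

Lemma normc_sqr z : normc z ^+ 2 = complex.Re z ^+ 2 + complex.Im z ^+ 2.
Proof. by case: z => a b /=; rewrite sqr_sqrtr// addr_ge0// sqr_ge0. Qed.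

Lemma normc_ge0 z : 0 <= normc z.
Proof. by case: z => a b; exact: sqrtr_ge0. Qed.

Lemma cReD z w : complex.Re (z + w) = complex.Re z + complex.Re w.
Proof. by case: z w => [a b] [c d]. Qed.
Lemma cImD z w : complex.Im (z + w) = complex.Im z + complex.Im w.
Proof. by case: z w => [a b] [c d]. Qed.
Lemma cReN z : complex.Re (- z) = - complex.Re z.
Proof. by case: z. Qed.
Lemma cImN z : complex.Im (- z) = - complex.Im z.
Proof. by case: z. Qed.
Lemma cReM z w :
  complex.Re (z * w) = complex.Re z * complex.Re w - complex.Im z * complex.Im w.
Proof. by case: z w => [a b] [c d]. Qed.
Lemma cImM z w :
  complex.Im (z * w) = complex.Re z * complex.Im w + complex.Im z * complex.Re w.
Proof. by case: z w => [a b] [c d]. Qed.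

Lemma cRe_sum (I : Type) (s : seq I) (F : I -> R[i]) :
  complex.Re (\sum_(i <- s) F i) = \sum_(i <- s) complex.Re (F i).
Proof. exact: (big_morph _ cReD). Qed.

Lemma cIm_sum (I : Type) (s : seq I) (F : I -> R[i]) :
  complex.Im (\sum_(i <- s) F i) = \sum_(i <- s) complex.Im (F i).
Proof. exact: (big_morph _ cImD). Qed.

Lemma normc_real x : normc (x%:C)%C = `|x|.
Proof. by rewrite /= expr0n/= addr0 sqrtr_sqr. Qed.

Lemma natrC n : (n%:R : R[i]) = (n%:R%:C)%C.
Proof. by rewrite (rmorph_nat (real_complex R)). Qed.

Lemma normc_nat n : normc (n%:R : R[i]) = n%:R.
Proof. by rewrite natrC normc_real ger0_norm. Qed.

Lemma natVrC n : ((n%:R)^-1 : R[i]) = ((n%:R)^-1%:C)%C.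
Proof. by rewrite natrC fmorphV. Qed.

Lemma normc_natV n : normc ((n%:R)^-1 : R[i]) = (n%:R)^-1.
Proof. by rewrite natVrC normc_real ger0_norm. Qed.

Lemma normcX z n : normc (z ^+ n) = normc z ^+ n.
Proof.
by elim: n => [|n IH]; rewrite ?expr0 ?Normc.normc1// exprS Normc.normcM IH exprS.
Qed.

Lemma normc_unitX z n : normc z = 1 -> normc (z ^+ n) = 1.
Proof. by move=> z1; rewrite normcX z1 expr1n. Qed.

Lemma normc_sum (I : Type) (s : seq I) (F : I -> R[i]) :
  normc (\sum_(i <- s) F i) <= \sum_(i <- s) normc (F i).
Proof.
elim: s => [|i s IH]; first by rewrite !big_nil Normc.normc0.
by rewrite !big_cons (le_trans (le_normcD _ _))// lerD2l.
Qed.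

Lemma normcB_sym z w : normc (z - w) = normc (w - z).
Proof. by rewrite -opprB normcN. Qed.

Lemma normc_Re z : `|complex.Re z| <= normc z.
Proof.
rewrite -(ler_pXn2r (n := 2)) ?nnegrE ?normc_ge0//.
by rewrite normc_sqr real_normK ?num_real// lerDl sqr_ge0.
Qed.

Lemma normc_Im z : `|complex.Im z| <= normc z.
Proof.
rewrite -(ler_pXn2r (n := 2)) ?nnegrE ?normc_ge0//.
by rewrite normc_sqr real_normK ?num_real// lerDr sqr_ge0.
Qed.

Lemma normc_le_ReIm z : normc z <= `|complex.Re z| + `|complex.Im z|.
Proof.
rewrite -(ler_pXn2r (n := 2)) ?nnegrE ?normc_ge0 ?addr_ge0//.
rewrite normc_sqr sqrrD !real_normK ?num_real// -addrA lerD2l lerDr.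
by rewrite mulrn_wge0// mulr_ge0.
Qed.

Lemma normc_le_sqrP z x : 0 <= x -> normc z ^+ 2 <= x ^+ 2 -> normc z <= x.
Proof. by move=> x0; rewrite ler_pXn2r ?nnegrE ?normc_ge0. Qed.

(** Bias-variance decomposition around the mean [u]. At [c = u] it yields Jensen's inequality; for
    general [c] it measures exactly what subtracting an eigenfunction gains. The mean is stated
    without division, so H = 0 is no separate case. *)
Lemma variance_identity (H : nat) (w : nat -> R[i]) (c u : R[i]) :
  H%:R * u = \sum_(h < H) w h ->
  \sum_(h < H) normc (w h - c) ^+ 2 =
  \sum_(h < H) normc (w h) ^+ 2 - H%:R * normc u ^+ 2 + H%:R * normc (u - c) ^+ 2.
Proof.
move/esym => E.
have ER : \sum_(h < H) complex.Re (w h) = H%:R * complex.Re u.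
  rewrite -(cRe_sum (index_enum _) (fun h : 'I_H => w h)) E natrC cReM/=.
  by rewrite mul0r subr0.
have EI : \sum_(h < H) complex.Im (w h) = H%:R * complex.Im u.
  rewrite -(cIm_sum (index_enum _) (fun h : 'I_H => w h)) E natrC cImM/=.
  by rewrite mul0r addr0.
have -> : \sum_(h < H) normc (w h - c) ^+ 2 = \sum_(h < H) normc (w h) ^+ 2
   - (complex.Re c *+ 2) * (\sum_(h < H) complex.Re (w h))
   - (complex.Im c *+ 2) * (\sum_(h < H) complex.Im (w h))
   + \sum_(h < H) normc c ^+ 2.
  rewrite !mulr_sumr -!sumrB -big_split/=; apply: eq_bigr => h _.
  by rewrite !normc_sqr cReD cImD cReN cImN; ring.
rewrite sumr_const card_ord ER EI -mulr_natl !normc_sqr cReD cImD cReN cImN; ring.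
Qed.

Lemma jensen_normc (H : nat) (w : nat -> R[i]) :
  normc (H%:R^-1 * \sum_(h < H) w h) ^+ 2 <=
  H%:R^-1 * \sum_(h < H) normc (w h) ^+ 2.
Proof.
have [->|H0] := posnP H; first by rewrite !big_ord0 !mulr0 Normc.normc0 expr0n.
set u := H%:R^-1 * _.
have : H%:R * u = \sum_(h < H) w h by rewrite mulVKf// pnatr_eq0 -lt0n.
move/variance_identity => /(_ u).
rewrite subrr Normc.normc0 expr0n/= mulr0 addr0 => E.
rewrite ler_pdivlMl ?ltr0n// -subr_ge0 -E; apply: sumr_ge0 => h _.
exact: sqr_ge0.
Qed.

End ComplexModulus.

(** * Limit superior of bounded real sequences *)

Section LimitSuperior.
Variable R : realType.
Implicit Types (u v : R^nat) (B t : R).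

Lemma le_norm_bounded_fun u B : (forall n, `|u n| <= B) -> bounded_fun u.
Proof.
move=> uB; exists B; split; first exact: num_real.
by move=> M BM n _ /=; exact: le_trans (uB n) (ltW BM).
Qed.

(** For a bounded sequence the real-valued [limn_sup] is the infimum of the tail suprema; this is
    why a bound [B] accompanies the statements here. *)
Lemma limn_sup_lt u B t : (forall n, `|u n| <= B) -> limn_sup u < t ->
  exists N0, forall n, (N0 <= n)%N -> u n < t.
Proof.
move=> uB; have ub := le_norm_bounded_fun uB.
rewrite limn_supE// => /inf_lt [|_ [m _ <-] mt].
  by exists (sups u 0%N); exists 0%N.
exists m => n mn; apply: le_lt_trans mt; apply: ub_le_sup; last by exists n.
exact/has_ubound_sdrop/bounded_fun_has_ubound.
Qed.

Lemma limn_sup_le u B t N0 : (forall n, `|u n| <= B) ->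
  (forall n, (N0 <= n)%N -> u n <= t) -> limn_sup u <= t.
Proof.
move=> uB ut; have ub := le_norm_bounded_fun uB.
rewrite limn_supE//; apply: (@le_trans _ _ (sups u N0)).
  by apply: ge_inf; [exact: bounded_fun_has_lbound_sups | exists N0].
by apply: ge_sup => [|_ [m /= Nm <-]]; [exists (u N0); exists N0 => /= | exact: ut].
Qed.

Lemma lt_limn_sup_freq u B t : (forall n, `|u n| <= B) -> t < limn_sup u ->
  forall N0, exists2 n, (N0 <= n)%N & t < u n.
Proof.
move=> uB tu N0; apply: contrapT => H.
suff : limn_sup u <= t by rewrite leNgt tu.
apply: (limn_sup_le (N0 := N0) uB) => n Nn; rewrite leNgt; apply/negP => tn.
by apply: H; exists n.
Qed.

Lemma limn_sup_leD u v B B' d : (forall n, `|u n| <= B) ->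
  (forall n, `|v n| <= B') -> (forall t, 0 < t ->
    exists N0, forall n, (N0 <= n)%N -> u n <= v n + d + t) ->
  limn_sup u <= limn_sup v + d.
Proof.
move=> uB vB H; apply/ler_addgt0Pl => e e0.
have [N1 H1] := H _ (divr_gt0 e0 (ltr0n R 2)).
have [|N2 H2] := @limn_sup_lt v B' (limn_sup v + e / 2) vB; first by lra.
apply: (limn_sup_le (N0 := maxn N1 N2) uB) => n; rewrite geq_max => /andP[n1 n2].
have := H1 _ n1; have := H2 _ n2; lra.
Qed.

End LimitSuperior.

(** * Convergence of complex sequences *)

Section ComplexLimits.
Variable R : realType.
Implicit Types (u v : nat -> R[i]).

(** Convergence with a real tolerance. In the topology of [R[i]^o] tolerances are elements of
    [R[i]]; [ccvg_cvg] makes the passage at the very end. *)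
Definition ccvg u (l : R[i]) := forall e : R, 0 < e ->
  exists N0, forall n, (N0 <= n)%N -> normc (u n - l) <= e.

Lemma ccvg_cauchy u : (forall e : R, 0 < e -> exists N0, forall n m,
    (N0 <= n)%N -> (N0 <= m)%N -> normc (u n - u m) <= e) -> exists l, ccvg u l.
Proof.
move=> H.
have cauchyR (v : nat -> R) : (forall n m, `|v n - v m| <= normc (u n - u m)) ->
    exists l : R, forall e, 0 < e -> exists N0, forall n, (N0 <= n)%N -> `|v n - l| <= e.
  move=> vu; have /cvg_ex[l vl] : cvgn v.
    apply/cauchy_cvgP/cauchy_exP => e e0; have [N0 HN] := H _ (divr_gt0 e0 (ltr0n R 2)).
    exists (v N0); exists N0 => // n /= Nn.
    have := le_trans (vu _ _) (HN _ _ (leqnn _) Nn).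
    by rewrite /ball /=; lra.
  exists l => e e0; have /cvgrPdist_le /(_ e e0)[N0 _ HN] := vl.
  by exists N0 => n Nn; rewrite distrC; exact: HN.
have [|lr Hr] := @cauchyR (fun n => complex.Re (u n)).
  by move=> n m; rewrite -cReN -cReD normc_Re.
have [|li Hi] := @cauchyR (fun n => complex.Im (u n)).
  by move=> n m; rewrite -cImN -cImD normc_Im.
exists (lr +i* li)%C => e e0.
have [N1 H1] := Hr _ (divr_gt0 e0 (ltr0n R 2)).
have [N2 H2] := Hi _ (divr_gt0 e0 (ltr0n R 2)).
exists (maxn N1 N2) => n; rewrite geq_max => /andP[n1 n2].
apply: (le_trans (normc_le_ReIm _)); rewrite cReD cReN cImD cImN/=.
by have := H1 _ n1; have := H2 _ n2; lra.
Qed.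

(** Eventual closeness to convergent sequences makes [u] Cauchy. Through this, convergence passes
    from exponentials to Wiener-Wintner sequences. *)
Lemma ccvg_approx u : (forall e : R, 0 < e -> exists v, (exists l, ccvg v l) /\
    exists N0, forall n, (N0 <= n)%N -> normc (u n - v n) <= e) ->
  exists l, ccvg u l.
Proof.
move=> H; apply: ccvg_cauchy => e e0; have e4 : 0 < e / 4 by lra.
have [v [[l vl] [N1 H1]]] := H _ e4; have [N2 H2] := vl _ e4.
exists (maxn N1 N2) => n m; rewrite !geq_max => /andP[n1 n2] /andP[m1 m2].
have -> : u n - u m = (u n - v n) + ((v n - l) + (- (v m - l) + - (u m - v m))) by ring.
apply: (le_trans (le_normcD _ _)); have := H1 _ n1.
have := le_normcD (v n - l) (- (v m - l) + - (u m - v m)).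
have := le_normcD (- (v m - l)) (- (u m - v m)).
have := H1 _ m1; have := H2 _ n2; have := H2 _ m2; rewrite !normcN; lra.
Qed.

Lemma ccvgM u v l k : ccvg u l -> ccvg v k -> ccvg (fun n => u n * v n) (l * k).
Proof.
move=> ul vk e e0.
pose K := normc l + normc k + 1.
have l0 := normc_ge0 l; have k0 := normc_ge0 k.
have K0 : 0 < K by rewrite /K; lra.
(* If both errors are at most d <= 1, the products differ by at most d (1 + |l| + |k|) = d K <= e /
   2. *)
pose d := Num.min 1 (e / (2 * K)).
have d0 : 0 < d by rewrite /d lt_min ltr01 divr_gt0// mulr_gt0.
have dK : d * (2 * K) <= e by rewrite -ler_pdivlMr ?mulr_gt0// /d ge_min lexx orbT.
have d1 : d <= 1 by rewrite /d ge_min lexx.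
have [N1 H1] := ul _ d0; have [N2 H2] := vk _ d0.
exists (maxn N1 N2) => n; rewrite geq_max => /andP[/H1 n1 /H2 n2].
have -> : u n * v n - l * k = (u n - l) * (v n - k) + (u n - l) * k + l * (v n - k) by ring.
apply: (le_trans (le_normcD _ _)); rewrite Normc.normcM.
have := le_normcD ((u n - l) * (v n - k)) ((u n - l) * k); rewrite !Normc.normcM.
have := normc_ge0 (u n - l); have := normc_ge0 (v n - k); move: n1 n2; rewrite /K in dK *.
move: (normc (u n - l)) (normc (v n - k)) (normc _) (normc l) (normc k) l0 k0 dK => x y p L M; nra.
Qed.

Lemma ccvgD u v l k : ccvg u l -> ccvg v k -> ccvg (fun n => u n + v n) (l + k).
Proof.
move=> ul vk e e0; have e2 : 0 < e / 2 by lra.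
have [N1 H1] := ul _ e2; have [N2 H2] := vk _ e2.
exists (maxn N1 N2) => n; rewrite geq_max => /andP[/H1 n1 /H2 n2].
rewrite opprD addrACA; apply: le_trans (le_normcD _ _) _; lra.
Qed.

Lemma ccvg_cst l : ccvg (fun=> l) l.
Proof. by move=> e e0; exists 0%N => n _; rewrite subrr Normc.normc0 ltW. Qed.

Lemma ccvg_cvg u l : ccvg u l -> cvgn (u : nat -> R[i]^o).
Proof.
move=> ul; apply/cvg_ex; exists (l : R[i]^o); apply/cvgrPdist_le => e.
(* A positive element of [R[i]] is real, so its real part serves as the tolerance. *)
rewrite ltcE/= => /andP[/eqP e1 e0]; have [N0 H] := ul _ e0.
exists N0 => // n /= /H; rewrite normcB_sym => nl.
have -> : e = ((complex.Re e)%:C)%C by case: e e1 {e0 nl H} => a b /= ->.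
by rewrite -lecR in nl.
Qed.

End ComplexLimits.

(** * Wiener-Wintner sequences and cube averages *)

(** As n is nonzero in F, X^n - 1 is separable and has n distinct roots; among n distinct n-th roots
    of unity one is primitive. *)
Lemma closed_prim_root (F : closedFieldType) (n : nat) :
  n%:R != 0 :> F -> exists w : F, n.-primitive_root w.
Proof.
move=> nF; have n0 : (0 < n)%N by case: n nF => //; rewrite eqxx.
have [r] := closed_field_poly_normal ('X^n - 1 : {poly F}).
rewrite (monicP _) ?monicXnsubC// scale1r => Er.
have /hasP[w _ ?] : has n.-primitive_root r; last by exists w.
apply: has_prim_root => //.
- by apply/allP => z; rewrite -root_prod_XsubC -Er.
- by rewrite -separable_prod_XsubC -Er separable_Xn_sub_1.
- by have := size_prod_XsubC r id; rewrite -Er size_XnsubC// => -[->].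
Qed.

(** * Fourier analysis on roots of unity *)

Section DiscreteFourier.
Variable R : realType.
Local Notation C := R[i].

Lemma prim_root_normc M (w : C) : M.-primitive_root w -> normc w = 1.
Proof.
move=> pw; have M0 := prim_order_gt0 pw.
have : normc w ^+ M = 1 by rewrite -normcX prim_expr_order// Normc.normc1.
by move/eqP; rewrite pexpr_eq1 ?normc_ge0// => /eqP.
Qed.

Lemma normc1_neq0 (w : C) : normc w = 1 -> w != 0.
Proof. by apply: contra_eq_neq => ->; rewrite Normc.normc0 eq_sym oner_eq0. Qed.

(** Orthogonality of characters: a geometric sum of ratio x = w^(k - n) with x^M = 1. Since k and n
    are below M, x = 1 only for k = n. *)
Lemma prim_root_sum M (w : C) k n : M.-primitive_root w -> (k < M)%N -> (n < M)%N ->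
  \sum_(j < M) (w ^+ j) ^+ k * (w^-1 ^+ j) ^+ n = if k == n then M%:R else 0.
Proof.
move=> pw kM nM; have w1 := prim_root_normc pw.
have w0 := normc1_neq0 w1.
pose x := w ^+ k * w^-1 ^+ n.
have -> : \sum_(j < M) (w ^+ j) ^+ k * (w^-1 ^+ j) ^+ n = \sum_(j < M) x ^+ j.
  by apply: eq_bigr => j _; rewrite /x exprMn -!exprM ![(j * _)%N]mulnC.
have x1 : (x == 1) = (k == n).
  rewrite /x exprVn -(inj_eq (mulIf (expf_neq0 n w0))) mulfVK ?expf_neq0// mul1r.
  by rewrite (eq_prim_root_expr pw) !modn_small.
rewrite -x1; case: eqVneq => [->|xn1].
  by under eq_bigr do rewrite expr1n; rewrite sumr_const card_ord.
have /eqP : (x - 1) * \sum_(j < M) x ^+ j = 0.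
  rewrite -subrX1 /x exprMn -!exprM ![(_ * M)%N]mulnC !exprM exprVn.
  by rewrite (prim_expr_order pw) invr1 !expr1n mulr1 subrr.
by rewrite mulf_eq0 subr_eq0 (negPf xn1) => /eqP.
Qed.

(** Write each square as a product with the conjugate, exchange the sums and use orthogonality; N <=
    M keeps the indices distinct modulo M. *)
Lemma parseval M (w : C) (N : nat) (a : nat -> C) :
  M.-primitive_root w -> (N <= M)%N ->
  \sum_(j < M) normc (\sum_(n < N) a n * (w^-1 ^+ j) ^+ n) ^+ 2 =
  M%:R * \sum_(n < N) normc (a n) ^+ 2.
Proof.
move=> pw NM; have w1 := prim_root_normc pw.
have toC (z : C) : ((normc z ^+ 2)%:C)%C = z * (z^*)%C.
  by rewrite -sqr_normc normc_def -rmorphXn/=; case: z.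
have cw : (w^-1^*)%C = w.
  have E : w * (w^*)%C = 1 by rewrite -toC w1 expr1n.
  by rewrite conjc_inv; apply: (mulIf (x := (w^*)%C)); rewrite ?mulVf ?E// conjc_eq0 normc1_neq0.
have cX j n : ((w^-1 ^+ j ^+ n)^*)%C = w ^+ j ^+ n by rewrite !rmorphXn [X in X ^+ j]cw.
have conjM (x y : C) : ((x * y)^*)%C = (x^*)%C * (y^*)%C by rewrite rmorphM.
have conj_sum (F : 'I_N -> C) : ((\sum_(n < N) F n)^*)%C = \sum_(n < N) ((F n)^*)%C.
  by rewrite rmorph_sum.
apply: complexI; rewrite rmorph_sum rmorphM/= rmorph_nat rmorph_sum/=.
under eq_bigr => j _.
  rewrite toC conj_sum big_distrlr/=.
  under eq_bigr => n _.
    under eq_bigr => m _.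
      rewrite conjM cX mulrACA.
      over.
    over.
  over.
rewrite exchange_big/= mulr_sumr; apply: eq_bigr => n _.
rewrite exchange_big/= toC.
under eq_bigr => m _.
  rewrite -mulr_sumr.
  under eq_bigr => j _ do rewrite mulrC.
  rewrite prim_root_sum ?(leq_trans (ltn_ord _) NM)//.
  over.
rewrite (bigD1 n)//= eqxx big1 ?addr0; first by rewrite mulrC.
move=> m mn; rewrite -(inj_eq (@ord_inj N)) in mn.
by rewrite (negPf mn) mulr0.
Qed.

(* On the group of 2N-th roots of unity the sum is the scalar product of the
   transform of [r] with the product of the transforms of [a] and [b]. *)
Lemma bilinear_bound N (a b r : nat -> C) (K e : R) : (0 < N)%N -> 0 <= K ->
  (forall n, normc (a n) <= K) -> (forall n, normc (b n) <= K) ->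
  (forall z, normc z = 1 -> normc (\sum_(k < 2 * N) z ^+ k * r k) <= e) ->
  normc (\sum_(n < N) \sum_(m < N) a n * b m * r (n + m)%N) <= e * (N%:R * K ^+ 2).
Proof.
move=> N0 K0 aK bK re; set M := (2 * N)%N in re *.
have M0 : (0 < M)%N by rewrite /M; lia.
have NM : (N <= M)%N by rewrite /M; lia.
have [|w pw] := @closed_prim_root C M; first by rewrite pnatr_eq0 -lt0n.
have w1 := prim_root_normc pw.
pose A (c : nat -> C) j := \sum_(n < N) c n * (w^-1 ^+ j) ^+ n.
pose Rh j := \sum_(k < M) (w ^+ j) ^+ k * r k.
have E : \sum_(j < M) Rh j * (A a j * A b j) =
    M%:R * \sum_(n < N) \sum_(m < N) a n * b m * r (n + m)%N.
  transitivity (\sum_(j < M) \sum_(n < N) \sum_(m < N) \sum_(k < M)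
     (a n * b m * r k) * ((w ^+ j) ^+ k * (w^-1 ^+ j) ^+ (n + m))).
    apply: eq_bigr => j _; rewrite /A big_distrlr/= mulr_sumr; apply: eq_bigr => n _.
    rewrite mulr_sumr; apply: eq_bigr => m _; rewrite mulr_suml; apply: eq_bigr => k _.
    by rewrite exprD; ring.
  rewrite exchange_big/= mulr_sumr; apply: eq_bigr => n _.
  rewrite exchange_big/= mulr_sumr; apply: eq_bigr => m _.
  rewrite exchange_big/=.
  (* No wrap-around: M = 2N exceeds every n + m, so orthogonality selects exactly k = n + m. *)
  have nmM : (n + m < M)%N by have := ltn_ord n; have := ltn_ord m; rewrite /M; lia.
  under eq_bigr => k _ do rewrite -mulr_sumr prim_root_sum//.
  rewrite (bigD1 (Ordinal nmM))//= eqxx big1 ?addr0; first by rewrite mulrC.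
  move=> k kn; rewrite -(inj_eq (@ord_inj M))/= in kn.
  by rewrite (negPf kn) mulr0.
have M0' : 0 < M%:R :> R by rewrite ltr0n.
rewrite -(ler_pM2l M0') -{1}(normc_nat R M) -Normc.normcM -E.
have AK c : (forall n, normc (c n) <= K) ->
    \sum_(j < M) normc (A c j) ^+ 2 <= M%:R * (N%:R * K ^+ 2).
  move=> cK; rewrite (parseval _ pw NM) ler_pM2l//.
  apply: (@le_trans _ _ (\sum_(n < N) K ^+ 2)).
    by apply: ler_sum => n _; rewrite ler_pXn2r ?nnegrE ?normc_ge0.
  by rewrite sumr_const card_ord mulr_natl.
apply: (le_trans (normc_sum _ _)).
(* The transform of [r] is bounded by e, the product of the other two by the mean of their squares,
   which Parseval sums. *)
apply: (@le_trans _ _ (\sum_(j < M) e * ((normc (A a j) ^+ 2 + normc (A b j) ^+ 2) / 2))).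
  apply: ler_sum => j _; rewrite !Normc.normcM.
  apply: ler_pM; rewrite ?mulr_ge0 ?normc_ge0//.
    by apply: re; rewrite normc_unitX.
  by have := sqr_ge0 (normc (A a j) - normc (A b j)); nra.
rewrite -mulr_sumr -mulr_suml big_split/=.
have e0 : 0 <= e by apply: le_trans (re 1 _); rewrite ?normc_ge0 ?Normc.normc1.
have := AK _ aK; have := AK _ bK; nra.
Qed.

End DiscreteFourier.

(** * Convergence of cube averages of Wiener-Wintner sequences *)

Section CubeSequences.
Variable R : realType.
Local Notation C := R[i].
Implicit Types (a b c A B D : nat -> C) (s : seq (C * C)).

Definition exp_sum s n : C := \sum_(p <- s) p.1 * p.2 ^+ n.

Definition unimodular s := forall p, p \in s -> normc p.2 = 1.

(** [N0] is chosen before z: the bound is uniform over the circle, as [bilinear_bound] requires. *)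
Definition ww_sequence a := forall e : R, 0 < e ->
  exists2 s, unimodular s & exists N0, forall N, (N0 <= N)%N ->
  forall z, normc z = 1 ->
  normc (\sum_(n < N) z ^+ n * (a n - exp_sum s n)) <= N%:R * e.

Definition bounded_seq a := exists2 K : R, 0 <= K & forall n, normc (a n) <= K.

(** For z = 1 the average is constant from N = 1 on. Otherwise (z - 1) times the geometric sum is
    z^N - 1, of modulus at most 2, and the average is O(1/N). *)
Lemma geometric_avg_cvg (q z : C) : normc z = 1 ->
  exists l, ccvg (fun N => N%:R^-1 * \sum_(n < N) q * z ^+ n) l.
Proof.
move=> z1; have [->|zn1] := eqVneq z 1.
  exists q => e e0; exists 1%N => n n0.
  under eq_bigr do rewrite expr1n mulr1.
  rewrite sumr_const card_ord -[q *+ _]mulr_natl mulKf ?subrr ?Normc.normc0 ?ltW//.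
  by rewrite pnatr_eq0 -lt0n.
exists 0 => e e0; have z0 : 0 < normc (z - 1).
  rewrite lt_neqAle normc_ge0 andbT eq_sym; apply: contra_neq zn1.
  by move/Normc.eq0_normc/eqP; rewrite subr_eq0 => /eqP.
pose K := normc q * 2 / normc (z - 1).
have [N0 N0P] : exists N0 : nat, K / e < N0%:R.
  by exists (Num.truncn (K / e)).+1; exact: truncnS_gt.
exists N0.+1 => n n0; rewrite subr0 Normc.normcM normc_natV -mulr_sumr Normc.normcM.
have S : normc (z - 1) * normc (\sum_(i < n) z ^+ i) <= 2.
  rewrite -Normc.normcM -subrX1; apply: (le_trans (le_normcD _ _)).
  by rewrite normcN Normc.normc1 normc_unitX.
have n0' : 0 < n%:R :> R by rewrite ltr0n (leq_trans _ n0).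
rewrite mulrC ler_pdivrMr//; apply: (@le_trans _ _ K).
  rewrite /K -mulrA ler_wpM2l ?normc_ge0//.
  by rewrite ler_pdivlMr// mulrC.
apply: (@le_trans _ _ (e * N0%:R)); first by rewrite mulrC -ler_pdivrMr ?ltW.
by rewrite ler_wpM2l ?ltW// ltr_nat.
Qed.

Lemma ccvg_sum (I : Type) (r : seq I) (u : I -> nat -> C) :
  (forall i, exists l, ccvg (u i) l) ->
  exists l, ccvg (fun n => \sum_(i <- r) u i n) l.
Proof.
move=> H; elim: r => [|i r [l IH]].
  by exists 0 => e e0; exists 0%N => n _; rewrite big_nil subrr Normc.normc0 ltW.
have [k Hk] := H i; exists (k + l) => e e0.
have [N0 HN] := ccvgD Hk IH e0; exists N0 => n /HN; by rewrite big_cons.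
Qed.

Lemma eq_ccvg (u v : nat -> C) : (forall n, u n = v n) ->
  (exists l, ccvg u l) -> exists l, ccvg v l.
Proof. by move=> uv [l ul]; exists l => e /ul[N0 H]; exists N0 => n /H; rewrite uv. Qed.

Lemma ww_twisted_avg_cvg a z : ww_sequence a -> normc z = 1 ->
  exists l, ccvg (fun N => N%:R^-1 * \sum_(n < N) a n * z ^+ n) l.
Proof.
move=> wa z1; apply: ccvg_approx => e e0; have [s us [N0 HN]] := wa _ e0.
(* [ccvg_sum] asks for convergence at every index p, not only at those in [s]. The conditionals turn
   a term with |p.2| different from 1 into 0 and change nothing on [s]. *)
exists (fun N => \sum_(p <- s) (N%:R^-1 * \sum_(n < N) (if normc p.2 == 1 then p.1 else 0)
   * (if normc p.2 == 1 then p.2 * z else 1) ^+ n)); split.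
  apply: ccvg_sum => p; apply: geometric_avg_cvg.
  by case: eqP => [p1|]; rewrite ?Normc.normcM ?p1 ?z1 ?mulr1 ?Normc.normc1.
exists N0.+1 => n Nn; rewrite -mulr_sumr exchange_big/= -mulrBr -sumrB.
rewrite Normc.normcM normc_natV mulrC.
have n0' : 0 < n%:R :> R by rewrite ltr0n (leq_trans _ Nn).
rewrite ler_pdivrMr// mulrC; apply: le_trans (HN n _ z z1); last exact: ltnW.
rewrite le_eqVlt; apply/orP; left; apply/eqP; congr (normc _); apply: eq_bigr => i _.
rewrite mulrBr mulrC; congr (_ - _); rewrite /exp_sum mulr_sumr.
apply: eq_big_seq => p /us ->; rewrite eqxx exprMn; ring.
Qed.

Definition cube_sum (a b c A B D : nat -> C) (N : nat) : C :=
  (N%:R ^+ 3)^-1 * \sum_(n < N) \sum_(m < N) \sum_(p < N)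
   (a n * b m * c p * A (n + m)%N * B (n + p)%N * D (m + p)%N).

Definition cube_cvg a b c A B D := exists l, ccvg (cube_sum a b c A B D) l.

(** Exchanging m and p, and rotating (n, m, p) in the next lemma, brings [B] or [D] into the slot n
    + m, the only one estimated directly. *)
Lemma cube_sum_swap a b c A B D N : cube_sum a b c A B D N = cube_sum a c b B A D N.
Proof.
rewrite /cube_sum; congr (_ * _); apply: eq_bigr => n _; rewrite exchange_big/=.
by apply: eq_bigr => m _; apply: eq_bigr => p _; rewrite [(p + m)%N]addnC; ring.
Qed.

Lemma cube_sum_rot a b c A B D N : cube_sum a b c A B D N = cube_sum b c a D A B N.
Proof.
rewrite /cube_sum; congr (_ * _).
rewrite exchange_big/=; apply: eq_bigr => m _; rewrite exchange_big/=.
apply: eq_bigr => p _; apply: eq_bigr => n _.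
by rewrite [(n + m)%N]addnC [(n + p)%N]addnC; ring.
Qed.

(** For fixed p, absorb B(n+p) into a_n and D(m+p) into b_m and apply [bilinear_bound] with K^2 for
    K. Summing over p with the factor c_p gives N K * 2N e * N K^4, and division by N^3 leaves 2 K^5
    e. *)
Lemma cube_sum_bound a b c A B D N (K e : R) : (0 < N)%N -> 0 <= K ->
  (forall n, normc (a n) <= K) -> (forall n, normc (b n) <= K) ->
  (forall n, normc (c n) <= K) -> (forall n, normc (B n) <= K) ->
  (forall n, normc (D n) <= K) ->
  (forall z, normc z = 1 -> normc (\sum_(k < 2 * N) z ^+ k * A k) <= (2 * N)%:R * e) ->
  normc (cube_sum a b c A B D N) <= 2 * K ^+ 5 * e.
Proof.
move=> N0 K0 aK bK cK BK DK Ae.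
have N0' : 0 < N%:R :> R by rewrite ltr0n.
rewrite /cube_sum Normc.normcM -natrX normc_natV natrX.
rewrite mulrC ler_pdivrMr ?exprn_gt0//.
under eq_bigr do rewrite exchange_big/=.
rewrite exchange_big/=.
have e0 : 0 <= (2 * N)%:R * e by apply: le_trans (Ae 1 _); rewrite ?normc_ge0 ?Normc.normc1.
apply: (@le_trans _ _ (\sum_(p < N) K * ((2 * N)%:R * e * (N%:R * (K ^+ 2) ^+ 2)))).
  apply: (le_trans (normc_sum _ _)); apply: ler_sum => p _.
  have -> : \sum_(n < N) \sum_(m < N)
      a n * b m * c p * A (n + m)%N * B (n + p)%N * D (m + p)%N =
      c p * \sum_(n < N) \sum_(m < N) (a n * B (n + p)%N) * (b m * D (m + p)%N) * A (n + m)%N.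
    rewrite mulr_sumr; apply: eq_bigr => n _; rewrite mulr_sumr; apply: eq_bigr => m _; ring.
  rewrite Normc.normcM ler_pM ?normc_ge0//.
  apply: (@bilinear_bound _ _ (fun n => a n * B (n + p)%N) (fun m => b m * D (m + p)%N)) => //.
  - exact: sqr_ge0.
  - by move=> n; rewrite Normc.normcM expr2 ler_pM ?normc_ge0.
  - by move=> n; rewrite Normc.normcM expr2 ler_pM ?normc_ge0.
rewrite sumr_const card_ord -mulr_natl natrM.
rewrite le_eqVlt; apply/orP; left; apply/eqP; ring.
Qed.

Lemma cube_sumB a b c A A' B D N :
  cube_sum a b c A B D N - cube_sum a b c A' B D N =
  cube_sum a b c (fun n => A n - A' n) B D N.
Proof.
rewrite /cube_sum -mulrBr -sumrB; congr (_ * _); apply: eq_bigr => n _.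
rewrite -sumrB; apply: eq_bigr => m _; rewrite -sumrB; apply: eq_bigr => p _; ring.
Qed.

Lemma cube_sum_exp_sum a b c s B D N :
  cube_sum a b c (exp_sum s) B D N =
  \sum_(p <- s) cube_sum a b c (fun n => p.1 * p.2 ^+ n) B D N.
Proof.
rewrite /cube_sum -mulr_sumr; congr (_ * _); rewrite [RHS]exchange_big/=.
apply: eq_bigr => n _; rewrite [RHS]exchange_big/=.
apply: eq_bigr => m _; rewrite [RHS]exchange_big/=.
by apply: eq_bigr => p _; rewrite /exp_sum mulr_sumr !mulr_suml.
Qed.

Lemma bounded_seq_common (l : seq (nat -> C)) : (forall i, (i < size l)%N ->
    bounded_seq (nth (fun=> 0) l i)) -> exists2 K : R, 0 <= K &
  forall i n, (i < size l)%N -> normc (nth (fun=> 0) l i n) <= K.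
Proof.
elim: l => [|a l IH] H; first by exists 0.
have [K K0 HK] := IH (fun i => H i.+1); have [L L0 HL] := H 0%N isT.
exists (K + L) => [|[|i] n il]; first exact: addr_ge0.
  by rewrite (le_trans (HL n))// lerDr.
by rewrite (le_trans (HK _ _ il))// lerDl.
Qed.

(** [cube_sum_bound] applied to [A] minus an exponential sum shows that the averages for [A] are
    close to a finite sum of averages with a single exponential in that slot. *)
Lemma cube_cvg_replace a b c A B D : ww_sequence A ->
  bounded_seq a -> bounded_seq b -> bounded_seq c -> bounded_seq B -> bounded_seq D ->
  (forall q z, normc z = 1 -> cube_cvg a b c (fun n => q * z ^+ n) B D) ->
  cube_cvg a b c A B D.
Proof.
move=> wA ba bb bc bB bD H.
have [|K K0 HK] := @bounded_seq_common [:: a; b; c; B; D].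
  by case=> [|[|[|[|[|]]]]].
(* The summand 1 keeps the divisor positive when K = 0. *)
have K5 : 0 < 2 * K ^+ 5 + 1 by rewrite ltr_wpDl// mulr_ge0// exprn_ge0.
apply: ccvg_approx => e e0; have [s us [N0 HN]] := wA _ (divr_gt0 e0 K5).
exists (cube_sum a b c (exp_sum s) B D); split.
  pose v p := cube_sum a b c (fun n => (if normc p.2 == 1 then p.1 else 0) *
     (if normc p.2 == 1 then p.2 else 1) ^+ n) B D.
  apply: (@eq_ccvg (fun N => \sum_(p <- s) v p N)).
    move=> N; rewrite cube_sum_exp_sum; apply: eq_big_seq => p /us p1.
    by rewrite /v p1 eqxx.
  by apply: ccvg_sum => p; apply: H; case: eqP; rewrite ?Normc.normc1.
(* The estimate for [A] is used at length 2N >= N0; the successor excludes N = 0. *)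
exists N0.+1 => N NN; rewrite cube_sumB.
apply: (@le_trans _ _ (2 * K ^+ 5 * (e / (2 * K ^+ 5 + 1)))).
  apply: cube_sum_bound => //; last 1 first.
  - move=> z z1; apply: HN z1; lia.
  - exact: leq_trans NN.
  - by move=> n; exact: (HK 0%N).
  - by move=> n; exact: (HK 1%N).
  - by move=> n; exact: (HK 2%N).
  - by move=> n; exact: (HK 3%N).
  - by move=> n; exact: (HK 4%N).
rewrite mulrA ler_pdivrMr//; nra.
Qed.

Lemma bounded_seq_exp q z : normc z = 1 -> bounded_seq (fun n => q * z ^+ n).
Proof.
move=> z1; exists (normc q); first exact: normc_ge0.
by move=> n; rewrite Normc.normcM normc_unitX// mulr1.
Qed.

(** The three exponentials multiply to (z1 z2)^n (z1 z3)^m (z2 z3)^p, so the triple sum factors into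
    twisted averages of a, b and c. *)
Lemma cube_cvg_exp a b c q1 z1 q2 z2 q3 z3 :
  ww_sequence a -> ww_sequence b -> ww_sequence c ->
  normc z1 = 1 -> normc z2 = 1 -> normc z3 = 1 ->
  cube_cvg a b c (fun n => q1 * z1 ^+ n) (fun n => q2 * z2 ^+ n) (fun n => q3 * z3 ^+ n).
Proof.
move=> wa wb wc u1 u2 u3.
have unitM x y : normc x = 1 -> normc y = 1 -> normc (x * y : C) = 1.
  by rewrite Normc.normcM => -> ->; rewrite mulr1.
have [la Ha] := ww_twisted_avg_cvg wa (unitM _ _ u1 u2).
have [lb Hb] := ww_twisted_avg_cvg wb (unitM _ _ u1 u3).
have [lc Hc] := ww_twisted_avg_cvg wc (unitM _ _ u2 u3).
have Hq := ccvgM (ccvg_cst (q1 * q2 * q3)) (ccvgM Ha (ccvgM Hb Hc)).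
apply: eq_ccvg (ex_intro _ _ Hq) => N.
rewrite /cube_sum 3!exprS expr0 mulr1 !invfM.
set SA := \sum_(n < N) a n * _; set SB := \sum_(n < N) b n * _; set SC := \sum_(n < N) c n * _.
have -> : \sum_(n < N) \sum_(m < N) \sum_(p < N) a n * b m * c p * (q1 * z1 ^+ (n + m))
   * (q2 * z2 ^+ (n + p)) * (q3 * z3 ^+ (m + p)) = q1 * q2 * q3 * (SA * (SB * SC)).
  rewrite /SB /SC big_distrlr/= big_distrlr/= mulr_sumr.
  apply: eq_bigr => n _; rewrite !mulr_sumr; apply: eq_bigr => m _.
  rewrite !mulr_sumr; apply: eq_bigr => p _; rewrite !exprD !exprMn; ring.
ring.
Qed.

Lemma ww_cube_cvg a b c A B D :
  ww_sequence a -> ww_sequence b -> ww_sequence c ->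
  ww_sequence A -> ww_sequence B -> ww_sequence D ->
  bounded_seq a -> bounded_seq b -> bounded_seq c ->
  bounded_seq A -> bounded_seq B -> bounded_seq D -> cube_cvg a b c A B D.
Proof.
move=> wa wb wc wA wB wD ba bb bc bA bB bD.
apply: cube_cvg_replace => // q1 z1 u1; have b1 := bounded_seq_exp q1 u1.
(* A swap puts [B] into the slot n + m; swapping back and rotating then puts [D] there. *)
apply: eq_ccvg (fun N => esym (cube_sum_swap _ _ _ _ _ _ N)) _.
apply: cube_cvg_replace => // q2 z2 u2; have b2 := bounded_seq_exp q2 u2.
apply: eq_ccvg (fun N => esym (cube_sum_swap _ _ _ _ _ _ N)) _.
apply: eq_ccvg (fun N => esym (cube_sum_rot _ _ _ _ _ _ N)) _.
apply: cube_cvg_replace => // q3 z3 u3.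
apply: eq_ccvg (fun N => cube_sum_rot _ _ _ _ _ _ N) _.
exact: cube_cvg_exp.
Qed.

End CubeSequences.

(** * Twisted averages along a sequence *)

Section UnitCircle.
Variable R : realType.
Implicit Types (t : R).

Definition expi t : R[i] := (cos t +i* sin t)%C.

Lemma normc_expi t : normc (expi t) = 1.
Proof. by rewrite /= cos2Dsin2 sqrtr1. Qed.

(** The angle is acos of the real part, with the sign of the imaginary part; 4 is a convenient bound
    for pi. *)
Lemma expi_onto (z : R[i]) : normc z = 1 -> exists2 t, `|t| <= 4 & z = expi t.
Proof.
case: z => a b z1.
have ab : a ^+ 2 + b ^+ 2 = 1 by have := normc_sqr (a +i* b)%C; rewrite z1 expr1n.
have a1 : -1 <= a <= 1 by have := sqr_ge0 b; nra.
have ai : a \in `[(-1), 1] by rewrite in_itv.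
have sb : sin (acos a) = `|b|.
  by rewrite sin_acos// -ab addrAC subrr add0r sqrtr_sqr.
have b4 : `|acos a| <= 4.
  rewrite ger0_norm ?acos_ge0// (le_trans (acos_lepi a1))//.
  by have := @pihalf_lt2 R; lra.
have [b0|b0] := leP 0 b.
  by exists (acos a) => //; rewrite /expi acosK// sb ger0_norm.
by exists (- acos a); rewrite ?normrN// /expi cosN sinN acosK// sb ltr0_norm// opprK.
Qed.

Lemma lipschitz_of_derive (f df : R -> R) : (forall x : R, is_derive x 1 f (df x)) ->
  (forall x, `|df x| <= 1) -> forall s t, `|f s - f t| <= `|s - t|.
Proof.
move=> Df df1.
suff H s t : s <= t -> `|f t - f s| <= `|t - s|.
  move=> s t; have [st|/ltW ts] := leP s t; last exact: H.
  by rewrite distrC [`|s - t|]distrC; exact: H.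
move=> st; have [|c _ ->] := @MVT_segment R f df s t st (fun x _ => Df x).
  by apply: derivable_within_continuous => x _; exact: ex_derive.
by rewrite normrM ler_piMl.
Qed.

Lemma expi_lipschitz s t : normc (expi s - expi t) <= 2 * `|s - t|.
Proof.
apply: (le_trans (normc_le_ReIm _)); rewrite cReD cReN cImD cImN/=.
have := @lipschitz_of_derive sin cos (fun x => is_derive_sin x) (@cos_max R) s t.
have := @lipschitz_of_derive cos (fun x => - sin x) (fun x => is_derive_cos x).
move/(_ (fun x => eq_ind_r (fun y => y <= 1) (sin_max x) (normrN _)))/(_ s t); lra.
Qed.

(** The grid has step 8 / (G + 1) and starts at -4, with G so large that L times the step is at most
    e. *)
Lemma circle_grid (L e : R) : 0 <= L -> 0 < e -> exists G : nat, forall t, `|t| <= 4 ->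
  exists2 i, (i <= G)%N & L * `|t - (8 * i%:R / G.+1%:R - 4)| <= e.
Proof.
move=> L0 e0; exists (Num.truncn (8 * L / e)) => t; rewrite ler_norml => /andP[t1 t2].
set G := Num.truncn _.
have G0 : 0 < G.+1%:R :> R by rewrite ltr0n.
have GL : 8 * L <= e * G.+1%:R by have := truncnS_gt (8 * L / e); rewrite ltr_pdivrMr// [_ * e]mulrC => /ltW.
(* Rounding down overshoots the last index G only at t = 4, and capping it there still leaves an
   error of one step. *)
pose x := (t + 4) * G.+1%:R / 8; pose i := minn (Num.truncn x) G.
have x0 : 0 <= x by rewrite /x divr_ge0// mulr_ge0; lra.
exists i; first exact: geq_minr.
have xi : `|x - i%:R| <= 1.
  have /andP[i1 i2] := truncn_itv x0; rewrite /i /minn; case: ltnP => H.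
    by rewrite ler_norml; move: i1 i2; rewrite -natr1; lra.
  have xG : x <= G.+1%:R by rewrite /x ler_pdivrMr// mulrC ler_wpM2l// ?(ltW G0)//; lra.
  have : G%:R <= x by apply: le_trans i1; rewrite ler_nat.
  by rewrite ler_norml; move: xG; rewrite -natr1; lra.
have -> : t - (8 * i%:R / G.+1%:R - 4) = (x - i%:R) * (8 / G.+1%:R).
  by rewrite /x; field; rewrite gt_eqF.
have G8 : 0 <= 8 / G.+1%:R :> R by rewrite divr_ge0.
rewrite normrM (ger0_norm G8).
apply: (@le_trans _ _ (L * (1 * (8 / G.+1%:R)))).
  by rewrite ler_wpM2l// ler_wpM2r.
by rewrite mul1r mulrA ler_pdivrMr// [L * 8]mulrC.
Qed.

End UnitCircle.

(** * Elementary bounds for averages and shifts *)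

Section Averages.
Variable R : realType.
Local Notation C := R[i].

Lemma eventually_div_le (c e : R) : 0 < e ->
  exists N0, forall N, (N0 <= N)%N -> c * N%:R^-1 <= e.
Proof.
move=> e0; exists (Num.truncn (c / e)).+1 => N NN.
have N0 : 0 < N%:R :> R by rewrite ltr0n (leq_trans _ NN).
rewrite ler_pdivrMr// mulrC -ler_pdivrMr// ltW// (lt_le_trans (truncnS_gt _))//.
by rewrite ler_nat.
Qed.

Lemma eventually_uniform (P : nat -> nat -> Prop) n :
  (forall i, (i <= n)%N -> exists N0, forall N, (N0 <= N)%N -> P i N) ->
  exists N0, forall i N, (i <= n)%N -> (N0 <= N)%N -> P i N.
Proof.
elim: n => [|n IH] H.
  by have [N0 H0] := H 0%N isT; exists N0 => i N; rewrite leqn0 => /eqP ->; exact: H0.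
have [i i_n|N1 H1] := IH; first by apply: H; exact: leqW.
have [N2 H2] := H n.+1 (leqnn _).
exists (maxn N1 N2) => i N; rewrite geq_max leq_eqVlt => /orP[/eqP ->|i_n] /andP[NN1 NN2].
  exact: H2.
exact: H1.
Qed.

Lemma avg_le H (g : nat -> R) (K : R) : 0 <= K ->
  (forall h, (h < H)%N -> g h <= K) -> H%:R^-1 * \sum_(h < H) g h <= K.
Proof.
move=> K0 gK; have [->|H0] := posnP H; first by rewrite big_ord0 mulr0.
rewrite ler_pdivrMl ?ltr0n//; apply: (@le_trans _ _ (\sum_(h < H) K)).
  by apply: ler_sum => h _; exact: gK.
by rewrite sumr_const card_ord mulr_natl.
Qed.

Lemma normc_avg_le H (w : nat -> C) (K : R) : 0 <= K ->
  (forall h, (h < H)%N -> normc (w h) <= K) ->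
  normc (H%:R^-1 * \sum_(h < H) w h) <= K.
Proof.
move=> K0 wK; rewrite Normc.normcM normc_natV.
apply: le_trans (avg_le K0 wK); rewrite ler_wpM2l ?invr_ge0//; exact: normc_sum.
Qed.

Lemma sum_ordS_shift (V : zmodType) (g : nat -> V) N :
  \sum_(n < N) g n.+1 = \sum_(n < N) g n + g N - g 0%N.
Proof.
elim: N => [|N IH]; first by rewrite !big_ord0 add0r subrr.
by rewrite !big_ord_recr/= IH addrAC -!addrA; congr (_ + _); rewrite addrC addrA.
Qed.

(** Each unit shift trades one end term for another. Terms in [0, B] make this cost at most B;
    complex terms of modulus at most K cost 2 K in the next lemma. *)
Lemma sum_ord_shift_le (g : nat -> R) (B : R) N H :
  (forall n, 0 <= g n <= B) ->
  `|\sum_(n < N) g (n + H)%N - \sum_(n < N) g n| <= H%:R * B.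
Proof.
move=> gB; elim: H => [|H IH].
  by under eq_bigr do rewrite addn0; rewrite subrr normr0 mul0r.
under eq_bigr do rewrite addnS -addSn.
rewrite (sum_ordS_shift (fun n => g (n + H)%N)).
have := gB (N + H)%N; have := gB (0 + H)%N; move: IH; rewrite -natr1 !ler_norml; lra.
Qed.

Lemma sum_ord_shift_normc (g : nat -> C) (K : R) N H :
  (forall n, normc (g n) <= K) ->
  normc (\sum_(n < N) g (n + H)%N - \sum_(n < N) g n) <= H%:R * (2 * K).
Proof.
move=> gK; elim: H => [|H IH].
  by under eq_bigr do rewrite addn0; rewrite subrr Normc.normc0 mul0r.
under eq_bigr do rewrite addnS -addSn.
rewrite (sum_ordS_shift (fun n => g (n + H)%N)).
set S := \sum_(n < N) g (n + H)%N; set S0 := \sum_(n < N) g n.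
have -> : S + g (N + H)%N - g (0 + H)%N - S0 = (S - S0) + (g (N + H)%N - g (0 + H)%N) by ring.
apply: (le_trans (le_normcD _ _)).
have := le_normcD (g (N + H)%N) (- g (0 + H)%N); rewrite normcN.
have := gK (N + H)%N; have := gK (0 + H)%N; move: IH; rewrite -natr1 -/S -/S0; lra.
Qed.

Lemma normc_exprB (z w : C) h : normc z = 1 -> normc w = 1 ->
  normc (z ^+ h - w ^+ h) <= h%:R * normc (z - w).
Proof.
move=> z1 w1; elim: h => [|h IH]; first by rewrite !expr0 subrr Normc.normc0 mul0r.
have -> : z ^+ h.+1 - w ^+ h.+1 = z * (z ^+ h - w ^+ h) + (z - w) * w ^+ h.
  by rewrite !exprS; ring.
apply: (le_trans (le_normcD _ _)).
by rewrite !Normc.normcM z1 normc_unitX// mulr1 mul1r -natr1 mulrDl mul1r lerD2r.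
Qed.

End Averages.

(** * Windowed twisted averages and their energy *)

Section TwistedAverages.
Variable R : realType.
Local Notation C := R[i].
Implicit Types (a : nat -> C) (z w : C) (K : R).

(** The phase starts afresh at the beginning of the window. For |z| = 1 this is z^(-n) times the
    window average of z^k a_k, with the same modulus. *)
Definition tavg H z a n : C := H%:R^-1 * \sum_(h < H) z ^+ h * a (n + h)%N.

Definition mean_sq N H z a : R := N%:R^-1 * \sum_(n < N) normc (tavg H z a n) ^+ 2.

(** The quantity P_j of the overview; window lengths are dyadic because doubling the window cannot
    raise the energy. *)
Definition energy j (t : R) a : R := limn_sup (fun N => mean_sq N (2 ^ j) (expi t) a).

Variables (a : nat -> C) (K : R).
Hypothesis aK : forall n, normc (a n) <= K.

Let K0 : 0 <= K. Proof. exact: le_trans (normc_ge0 _) (aK 0). Qed.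

Lemma tavg_le H z n : normc z = 1 -> normc (tavg H z a n) <= K.
Proof.
move=> z1; apply: (normc_avg_le (w := fun h => z ^+ h * a (n + h)%N)) => // h _.
by rewrite Normc.normcM normc_unitX// mul1r.
Qed.

Lemma tavg_sq_bound H z n : normc z = 1 -> 0 <= normc (tavg H z a n) ^+ 2 <= K ^+ 2.
Proof.
move=> z1; rewrite sqr_ge0 ler_pXn2r ?nnegrE ?normc_ge0//.
exact: tavg_le.
Qed.

Lemma mean_sq_bound N H z : normc z = 1 -> `|mean_sq N H z a| <= K ^+ 2.
Proof.
move=> z1; rewrite ger0_norm; last first.
  by rewrite mulr_ge0 ?invr_ge0// sumr_ge0// => n _; exact: sqr_ge0.
apply: (avg_le (g := fun n => normc (tavg H z a n) ^+ 2)) => [|n _]; first exact: sqr_ge0.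
by case/andP: (tavg_sq_bound H n z1).
Qed.

Lemma tavg_lipschitz H z w n : normc z = 1 -> normc w = 1 ->
  normc (tavg H z a n - tavg H w a n) <= K * H%:R * normc (z - w).
Proof.
move=> z1 w1; rewrite /tavg -mulrBr -sumrB.
apply: (normc_avg_le (w := fun h => z ^+ h * a (n + h)%N - w ^+ h * a (n + h)%N)).
  by rewrite !mulr_ge0 ?normc_ge0.
move=> h hH; rewrite -mulrBl Normc.normcM mulrC -mulrA.
rewrite ler_pM ?normc_ge0//; apply: (le_trans (normc_exprB _ z1 w1)).
by rewrite ler_wpM2r ?normc_ge0// ler_nat ltnW.
Qed.

Lemma mean_sq_lipschitz N H z w : normc z = 1 -> normc w = 1 ->
  mean_sq N H z a <= mean_sq N H w a + 2 * K * (K * H%:R * normc (z - w)).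
Proof.
move=> z1 w1; set d := K * H%:R * _.
have d0 : 0 <= 2 * K * d by rewrite !mulr_ge0 ?normc_ge0.
rewrite -lerBlDl /mean_sq -mulrBr -sumrB.
apply: (avg_le (g := fun n => normc (tavg H z a n) ^+ 2 - normc (tavg H w a n) ^+ 2)) => // n _.
have := le_normcD (tavg H w a n) (tavg H z a n - tavg H w a n); rewrite addrC subrK.
have := tavg_lipschitz H n z1 w1; rewrite -/d.
have := tavg_le H n z1; have := tavg_le H n w1.
have := normc_ge0 (tavg H z a n); have := normc_ge0 (tavg H w a n).
have := normc_ge0 (tavg H z a n - tavg H w a n).
move: (normc _) (normc _) (normc _) => Y X D D0 X0 Y0 XK YK Dd YXD.
(* Certificates for Y^2 - X^2 = (X + Y)(Y - X) <= (X + Y) d <= 2 K d. *)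
have p1 : 0 <= (X + Y) * (d - (Y - X)) by apply: mulr_ge0; lra.
have p2 : 0 <= d * (2 * K - X - Y) by apply: mulr_ge0; lra.
nra.
Qed.

Lemma tavg_double H z n :
  tavg (2 * H) z a n = (tavg H z a n + z ^+ H * tavg H z a (n + H)) / 2.
Proof.
rewrite /tavg mul2n -addnn big_split_ord/= natrD.
have -> : \sum_(i < H) z ^+ (H + i) * a (n + (H + i))%N =
   z ^+ H * \sum_(i < H) z ^+ i * a (n + H + i)%N.
  by rewrite mulr_sumr; apply: eq_bigr => i _; rewrite exprD addnA mulrA.
have -> : (H%:R + H%:R : C)^-1 = H%:R^-1 / 2.
  by rewrite -invfM; congr (_^-1); ring.
ring.
Qed.

(** By convexity the squared mean of two half windows is at most the mean of their squares. The
    second half is a shift by H of the first, which accounts for the boundary term. *)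
Lemma mean_sq_double N H z : normc z = 1 ->
  mean_sq N (2 * H) z a <= mean_sq N H z a + H%:R * K ^+ 2 * N%:R^-1.
Proof.
move=> z1; pose g n := normc (tavg H z a n) ^+ 2.
have -> : H%:R * K ^+ 2 / N%:R = N%:R^-1 * (H%:R * K ^+ 2) by rewrite mulrC.
rewrite /mean_sq -mulrDr ler_wpM2l ?invr_ge0//.
apply: (@le_trans _ _ (\sum_(n < N) ((g n + g (n + H)%N) / 2))).
  apply: ler_sum => n _; rewrite tavg_double Normc.normcM normc_natV exprMn.
  have := le_normcD (tavg H z a n) (z ^+ H * tavg H z a (n + H)).
  rewrite (Normc.normcM (z ^+ H)) normc_unitX// mul1r /g.
  have := normc_ge0 (tavg H z a n + z ^+ H * tavg H z a (n + H)).
  have := sqr_ge0 (normc (tavg H z a n) - normc (tavg H z a (n + H))); nra.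
have gB n : 0 <= g n <= K ^+ 2 by exact: tavg_sq_bound.
rewrite -mulr_suml big_split/=.
have := sum_ord_shift_le N H gB; rewrite ler_norml.
have : 0 <= H%:R * K ^+ 2 by rewrite mulr_ge0// sqr_ge0.
rewrite /g; lra.
Qed.

Lemma energy_le_double j t : energy j.+1 t a <= energy j t a.
Proof.
have z1 := normc_expi t; rewrite -[leRHS]addr0.
apply: (@limn_sup_leD _ _ _ (K ^+ 2) (K ^+ 2)) => [N|N|e e0]; try exact: mean_sq_bound.
have [N0 HN] := eventually_div_le ((2 ^ j)%:R * K ^+ 2) e0.
exists N0 => N /HN NN; rewrite addr0 expnS.
by have := mean_sq_double N (2 ^ j) z1; lra.
Qed.

Lemma energy_anti i j t : (i <= j)%N -> energy j t a <= energy i t a.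
Proof.
elim: j => [|j IH]; first by rewrite leqn0 => /eqP ->.
rewrite leq_eqVlt => /orP[/eqP -> //|ij].
exact: le_trans (energy_le_double _ _) (IH ij).
Qed.

(** The factor 4 is 2 from the difference of squares times 2 from the Lipschitz constant of
    [expi]. *)
Lemma energy_lipschitz j s t :
  energy j s a <= energy j t a + 4 * K ^+ 2 * (2 ^ j)%:R * `|s - t|.
Proof.
apply: (@limn_sup_leD _ _ _ (K ^+ 2) (K ^+ 2)) => [N|N|e e0];
  try by apply: mean_sq_bound; exact: normc_expi.
exists 0%N => N _.
have := mean_sq_lipschitz N (2 ^ j) (normc_expi s) (normc_expi t).
have := expi_lipschitz s t.
have : 0 <= 2 * K * (K * (2 ^ j)%:R) by rewrite !mulr_ge0.
set L := _ * (_ * _) => L0 est.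
have : L * normc (expi s - expi t) <= L * (2 * `|s - t|) by rewrite ler_wpM2l.
have -> : 4 * K ^+ 2 * (2 ^ j)%:R * `|s - t| = L * (2 * `|s - t|) by rewrite /L; ring.
have -> : 2 * K * (K * (2 ^ j)%:R * normc (expi s - expi t)) = L * normc (expi s - expi t).
  by rewrite /L; ring.
lra.
Qed.

Lemma mean_sq_shift N H z : normc z = 1 ->
  `|mean_sq N H z (fun n => a n.+1) - mean_sq N H z a| <= K ^+ 2 * N%:R^-1.
Proof.
move=> z1; pose g n := normc (tavg H z a n) ^+ 2.
have gB n : 0 <= g n <= K ^+ 2 by exact: tavg_sq_bound.
rewrite /mean_sq -mulrBr normrM ger0_norm ?invr_ge0// mulrC ler_wpM2r ?invr_ge0//.
have := sum_ord_shift_le N 1 gB; rewrite mul1r.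
congr (`|_ - _| <= _); apply: eq_bigr => n _; by rewrite /g addn1.
Qed.

(** A shift changes [mean_sq] by at most K^2 / N, which the limit superior ignores. Hence the energy
    is constant along orbits. *)
Lemma energy_shift j t : energy j t (fun n => a n.+1) = energy j t a.
Proof.
have z1 := normc_expi t.
have bS N : `|mean_sq N (2 ^ j) (expi t) (fun n => a n.+1)| <= K ^+ 2 + K ^+ 2 * N%:R^-1.
  have := mean_sq_shift N (2 ^ j) z1; have := mean_sq_bound N (2 ^ j) z1.
  by rewrite !ler_norml; lra.
have bS' N : `|mean_sq N (2 ^ j) (expi t) (fun n => a n.+1)| <= K ^+ 2 + K ^+ 2.
  apply: (le_trans (bS N)); rewrite lerD2l ler_piMr ?sqr_ge0//.
  by case: N => [|N]; rewrite ?invr0// invf_le1 ?ler1n.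
apply/eqP; rewrite eq_le; apply/andP; split; rewrite -[leRHS]addr0.
- apply: (@limn_sup_leD _ _ _ (K ^+ 2 + K ^+ 2) (K ^+ 2)) => [N|N|e e0] //; first exact: mean_sq_bound.
  have [N0 HN] := eventually_div_le (K ^+ 2) e0; exists N0 => N /HN.
  by have := mean_sq_shift N (2 ^ j) z1; rewrite ler_norml; lra.
- apply: (@limn_sup_leD _ _ _ (K ^+ 2) (K ^+ 2 + K ^+ 2)) => [N|N|e e0] //; first exact: mean_sq_bound.
  have [N0 HN] := eventually_div_le (K ^+ 2) e0; exists N0 => N /HN.
  by have := mean_sq_shift N (2 ^ j) z1; rewrite ler_norml; lra.
Qed.

(* The van der Corput inequality. *)
Lemma twisted_sum_le N H z (e : R) : (0 < H)%N -> normc z = 1 -> 0 <= e ->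
  mean_sq N H z a <= e ^+ 2 ->
  normc (\sum_(n < N) z ^+ n * a n) <= N%:R * e + 2 * K * H%:R.
Proof.
move=> H0 z1 e0 me; pose x n := z ^+ n * a n.
have [->|N0] := posnP N; first by rewrite big_ord0 Normc.normc0 mul0r add0r !mulr_ge0.
have xK n : normc (x n) <= K by rewrite /x Normc.normcM normc_unitX// mul1r.
(* [S'] is the mean of H shifted copies of the sum, so it differs from the sum by boundary terms
   only; Jensen's inequality then bounds it by the mean square of the windows. *)
pose S' := \sum_(n < N) z ^+ n * tavg H z a n.
have S'E : S' = H%:R^-1 * \sum_(h < H) \sum_(n < N) x (n + h)%N.
  rewrite exchange_big/= mulr_sumr; apply: eq_bigr => n _.
  rewrite /tavg mulrCA; congr (_ * _); rewrite mulr_sumr; apply: eq_bigr => h _.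
  by rewrite mulrA -exprD.
have diff : normc (\sum_(n < N) x n - S') <= 2 * K * H%:R.
  have -> : \sum_(n < N) x n - S' =
      H%:R^-1 * \sum_(h < H) (\sum_(n < N) x n - \sum_(n < N) x (n + h)%N).
    rewrite sumrB mulrBr -S'E sumr_const card_ord -[(\sum_(n < N) x n) *+ _]mulr_natl mulKf//.
    by rewrite pnatr_eq0 -lt0n.
  apply: (normc_avg_le (w := fun h => \sum_(n < N) x n - \sum_(n < N) x (n + h)%N)).
    by rewrite !mulr_ge0.
  move=> h hH; rewrite normcB_sym (le_trans (sum_ord_shift_normc _ _ xK))//.
  by rewrite mulrC ler_wpM2l ?mulr_ge0// ler_nat ltnW.
have S'e : normc S' <= N%:R * e.
  apply: normc_le_sqrP; first by rewrite mulr_ge0.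
  have -> : S' = N%:R * (N%:R^-1 * S') by rewrite mulVKf// pnatr_eq0 -lt0n.
  rewrite Normc.normcM normc_nat !exprMn ler_wpM2l ?exprn_ge0//.
  apply: (le_trans (jensen_normc _ (fun n => z ^+ n * tavg H z a n))).
  apply: le_trans me; rewrite /mean_sq le_eqVlt; apply/orP; left; apply/eqP.
  congr (_ * _); apply: eq_bigr => n _.
  by rewrite Normc.normcM normc_unitX// mul1r.
have := le_normcD S' (\sum_(n < N) x n - S'); rewrite addrC subrK /x => H1.
apply: (le_trans H1); exact: lerD.
Qed.

(** On a finite grid of angles [mean_sq] is below e^2 from a common N on, and Lipschitz continuity
    extends this to the whole circle. Van der Corput then gives 2e, plus e for the boundary term. *)
Lemma small_energy_twisted_sum j (e : R) : 0 < e ->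
  (forall t, `|t| <= 4 -> energy j t a < e ^+ 2) ->
  exists N0, forall N, (N0 <= N)%N -> forall z, normc z = 1 ->
    normc (\sum_(n < N) z ^+ n * a n) <= N%:R * (3 * e).
Proof.
move=> e0 He; set H := (2 ^ j)%N.
have H0 : (0 < H)%N by rewrite expn_gt0.
pose L := 2 * K * (K * H%:R) * 2.
have L0 : 0 <= L by rewrite !mulr_ge0.
have e20 : 0 < e ^+ 2 by rewrite exprn_gt0.
have [G HG] := circle_grid L0 e20.
pose pt i := 8 * i%:R / G.+1%:R - 4 : R.
have pt4 i : (i <= G)%N -> `|pt i| <= 4.
  move=> iG; rewrite ler_norml /pt; apply/andP; split.
    by rewrite lerBrDl subrr divr_ge0// mulr_ge0.
  rewrite lerBlDl ler_pdivrMr ?ltr0n//.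
  have : i%:R <= G.+1%:R :> R by rewrite ler_nat ltnW.
  lra.
have [i iG|N1 HN1] := @eventually_uniform
    (fun i N => mean_sq N H (expi (pt i)) a < e ^+ 2) G.
  apply: (@limn_sup_lt _ _ (K ^+ 2)); last by apply: He; exact: pt4.
  by move=> N; apply: mean_sq_bound; exact: normc_expi.
have [N2 HN2] := eventually_div_le (2 * K * H%:R) e0.
exists (maxn N1 N2).+1 => N NN z z1.
have N0 : (0 < N)%N by exact: leq_trans NN.
have NN1 : (N1 <= N)%N by lia.
have NN2 : (N2 <= N)%N by lia.
have [t t4 zt] := expi_onto z1; have [i iG Lt] := HG _ t4.
(* The nearest grid point costs L / 2 times the distance on the circle, at most e^2; so [mean_sq] is
   at most 2 e^2 <= (2 e)^2. *)
have me : mean_sq N H z a <= (2 * e) ^+ 2.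
  have := mean_sq_lipschitz N H z1 (normc_expi (pt i)).
  have := HN1 _ _ iG NN1; have : L * normc (z - expi (pt i)) <= 2 * e ^+ 2.
    rewrite {1}zt; have := expi_lipschitz t (pt i).
    by move/(ler_wpM2l L0); move: Lt; rewrite -/(pt i); lra.
  rewrite /L exprMn; move: e20; nra.
have e2 : 0 <= 2 * e by rewrite mulr_ge0// ltW.
apply: (le_trans (twisted_sum_le H0 z1 e2 me)).
have := HN2 _ NN2; rewrite ler_pdivrMr ?ltr0n// => H2.
by rewrite mulrC; lra.
Qed.

End TwistedAverages.

(** * Measurable choice of a peak angle *)

Section PeakSelection.
Variable R : realType.
Local Notation C := R[i].

(** An explicit search through a list, because the selected angle must depend measurably on the
    point of X. *)
Fixpoint first_above (q : R -> R) (e : R) (s : seq R) : R :=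
  if s is t :: s' then if e <= q t then t else first_above q e s' else 0.

Lemma first_aboveP q e s t : t \in s -> e <= q t -> e <= q (first_above q e s).
Proof.
elim: s => [//|u s IH]; rewrite inE /= => /predU1P[->|ts] et; first by rewrite et.
by case: ifP => // _; exact: IH.
Qed.

Lemma first_above_le q e s (B : R) : 0 <= B -> (forall t, t \in s -> `|t| <= B) ->
  `|first_above q e s| <= B.
Proof.
move=> B0; elim: s => [_|t s IH H] /=; first by rewrite normr0.
case: ifP => _; first by apply: H; rewrite mem_head.
by apply: IH => u us; apply: H; rewrite inE us orbT.
Qed.

(** The Lipschitz constant 4 K^2 2^j of [energy j] is common to all sequences bounded by K, so one
    grid per j serves every orbit at a loss of 1 / (j + 1). *)
Lemma energy_grids (K : R) : 0 <= K -> exists grid : nat -> seq R,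
  (forall j t, t \in grid j -> `|t| <= 4) /\
  forall j (a : nat -> C) e t, (forall n, normc (a n) <= K) -> `|t| <= 4 ->
    e <= energy j t a ->
    exists2 s, s \in grid j & e - j.+1%:R^-1 <= energy j s a.
Proof.
move=> K0.
have step j : exists g : seq R, (forall t, t \in g -> `|t| <= 4) /\
    forall (a : nat -> C) e t, (forall n, normc (a n) <= K) -> `|t| <= 4 ->
      e <= energy j t a -> exists2 s, s \in g & e - j.+1%:R^-1 <= energy j s a.
  have L0 : 0 <= 4 * K ^+ 2 * (2 ^ j)%:R by rewrite !mulr_ge0// sqr_ge0.
  have j0 : 0 < j.+1%:R^-1 :> R by rewrite invr_gt0.
  have [G HG] := circle_grid L0 j0.
  pose f (i : nat) : R := 8 * i%:R / G.+1%:R - 4.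
  exists (map f (iota 0 G.+1)); split.
    move=> t /mapP[k]; rewrite mem_iota/= add0n ltnS => kG ->.
    rewrite /f ler_norml; apply/andP; split.
      by rewrite lerBrDl subrr divr_ge0// mulr_ge0.
    rewrite lerBlDl ler_pdivrMr ?ltr0n//.
    have : k%:R <= G.+1%:R :> R by rewrite ler_nat ltnW.
    lra.
  move=> a e t aK t4 et; have [i iG Hi] := HG _ t4.
  exists (f i); first by apply: map_f; rewrite mem_iota/= add0n ltnS.
  have := energy_lipschitz aK j t (f i); move: Hi et; rewrite -/(f i).
  by move=> h1 h2 h3; rewrite lerBlDr (le_trans h2)// (le_trans h3)// lerD2l.
have [g Hg] := choice step.
by exists g; split => [j|j a e t]; [exact: (Hg j).1 | exact: (Hg j).2].
Qed.

(* A cluster point of points of finer and finer grids at which [q j] is at least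
   [e - 1 / (j + 1)]; [first_above] returns the junk value 0 if there is none. *)
Definition peak (grid : nat -> seq R) (e : R) (q : nat -> R -> R) : R :=
  limn_sup (fun j => first_above (q j) (e - j.+1%:R^-1) (grid j)).

(** For j >= i, monotonicity gives energy i (th j) >= energy j (th j) >= e - 1 / (j + 1).
    Arbitrarily late [th j] lie near their limit superior p, and Lipschitz continuity of [energy i]
    carries the bound to p. *)
Lemma peak_energy (K : R) (grid : nat -> seq R) (a : nat -> C) (e : R) :
  (forall j t, t \in grid j -> `|t| <= 4) ->
  (forall j (a : nat -> C) e t, (forall n, normc (a n) <= K) -> `|t| <= 4 ->
    e <= energy j t a ->
    exists2 s, s \in grid j & e - j.+1%:R^-1 <= energy j s a) ->
  (forall n, normc (a n) <= K) ->
  (forall j, exists2 t, `|t| <= 4 & e <= energy j t a) ->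
  forall i, e <= energy i (peak grid e (fun j t => energy j t a)) a.
Proof.
move=> g4 Hg aK ea i.
pose th j := first_above (fun t => energy j t a) (e - j.+1%:R^-1) (grid j).
have th4 j : `|th j| <= 4 by apply: first_above_le => // t; exact: g4.
have the j : e - j.+1%:R^-1 <= energy j (th j) a.
  have [t t4 et] := ea j; have [s sg es] := Hg _ _ _ _ aK t4 et.
  exact: (@first_aboveP (fun t => energy j t a) _ _ _ sg es).
rewrite -[peak _ _ _]/(limn_sup th); set p := limn_sup th.
pose L := 4 * K ^+ 2 * (2 ^ i)%:R.
have K0 : 0 <= K by exact: le_trans (normc_ge0 _) (aK 0).
have L0 : 0 <= L by rewrite /L !mulr_ge0.
apply/ler_addgt0Pr => d d0.
have L1 : 0 < L + 1 by lra.
(* Moving the angle by h costs at most L h <= d / 2; the other d / 2 pays for 1 / (j + 1). *)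
pose h := d / 2 / (L + 1).
have h0 : 0 < h by rewrite !divr_gt0.
have hL : L * h <= d / 2.
  by rewrite /h mulrA ler_pdivrMr//; nra.
have [|N1 H1] := limn_sup_lt (t := p + h) th4; first by rewrite ltrDl.
have [N2 H2] := eventually_div_le 1 (divr_gt0 d0 (ltr0n R 2)).
have [|j jN pj] := lt_limn_sup_freq (t := p - h) th4 _ (maxn i (maxn N1 N2)).
  by rewrite ltrBlDr ltrDl.
have ij : (i <= j)%N by lia.
have jN1 : (N1 <= j)%N by lia.
have jN2 : (N2 <= j.+1)%N by lia.
have := H1 _ jN1; have := H2 _ jN2; rewrite mul1r => jd pj'.
have dist : `|th j - p| <= h by rewrite ler_norml; lra.
have LD : L * `|th j - p| <= L * h by rewrite ler_wpM2l.
have := energy_lipschitz aK i (th j) p; rewrite -/L => E1.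
have := energy_anti aK (th j) ij => E2.
have E3 : e - d / 2 <= energy j (th j) a by apply: le_trans (the j); rewrite lerD2l lerN2.
rewrite -lerBlDr; apply: (le_trans _ (_ : energy i (th j) a - d / 2 <= _)); last first.
  by rewrite lerBlDr (le_trans E1)// lerD2l (le_trans LD).
by rewrite {1}(splitr d) opprD addrA lerD2r (le_trans E3).
Qed.

End PeakSelection.

(** * Composition, shift and variance of twisted averages *)

Section TwistedErgodic.
Variable R : realType.
Local Notation C := R[i].
Variables (a : nat -> C) (K : R).
Hypothesis aK : forall n, normc (a n) <= K.

Let K0 : 0 <= K. Proof. exact: le_trans (normc_ge0 _) (aK 0). Qed.

(** Averaging first over short windows H' is a mean of shifts by less than H', each costing a
    boundary term. A much longer window H does not notice it. *)
Lemma tavg_tavg H H' z n : (0 < H)%N -> (0 < H')%N -> normc z = 1 ->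
  normc (tavg H z (tavg H' z a) n - tavg H z a n) <= 2 * K * H'%:R / H%:R.
Proof.
move=> H0 H'0 z1; pose y h := z ^+ h * a (n + h)%N.
have yK h : normc (y h) <= K by rewrite /y Normc.normcM normc_unitX// mul1r.
have -> : tavg H z (tavg H' z a) n - tavg H z a n =
    H'%:R^-1 * \sum_(k < H') (H%:R^-1 * (\sum_(h < H) y (h + k)%N - \sum_(h < H) y h)).
  under [in RHS]eq_bigr do rewrite mulrBr.
  rewrite sumrB mulrBr; congr (_ - _); last first.
    rewrite sumr_const card_ord -[(H%:R^-1 * _) *+ H']mulr_natl mulKf//.
    by rewrite pnatr_eq0 -lt0n.
  rewrite /tavg -mulr_sumr mulrCA; congr (_ * _).
  rewrite exchange_big/= mulr_sumr; apply: eq_bigr => h _.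
  rewrite mulrCA; congr (_ * _); rewrite mulr_sumr; apply: eq_bigr => k _.
  by rewrite /y exprD mulrA addnA.
apply: (normc_avg_le (w := fun k => H%:R^-1 * (\sum_(h < H) y (h + k)%N - \sum_(h < H) y h))).
  by rewrite divr_ge0// !mulr_ge0.
move=> k kH; rewrite Normc.normcM normc_natV mulrC ler_wpM2r ?invr_ge0//.
apply: (le_trans (sum_ord_shift_normc _ _ yK)).
by rewrite mulrC ler_wpM2l ?mulr_ge0// ler_nat ltnW.
Qed.

(** As H grows this becomes the eigenfunction relation c(Tx) = z^(-1) c(x). *)
Lemma tavg_shift H z n : (0 < H)%N -> normc z = 1 ->
  normc (z * tavg H z a n.+1 - tavg H z a n) <= 2 * K / H%:R.
Proof.
move=> H0 z1; pose y h := z ^+ h * a (n + h)%N.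
have yK h : normc (y h) <= K by rewrite /y Normc.normcM normc_unitX// mul1r.
have -> : z * tavg H z a n.+1 - tavg H z a n =
   H%:R^-1 * (\sum_(h < H) y (h + 1)%N - \sum_(h < H) y h).
  rewrite mulrBr /tavg mulrCA; congr (_ * _ - _); rewrite mulr_sumr.
  by apply: eq_bigr => h _; rewrite /y mulrA -exprS addn1 addSnnS.
rewrite Normc.normcM normc_natV mulrC ler_wpM2r ?invr_ge0//.
by rewrite (le_trans (sum_ord_shift_normc _ _ yK))// mul1r.
Qed.

Lemma tavg_sq_le H z n : normc z = 1 ->
  normc (tavg H z a n) ^+ 2 <= H%:R^-1 * \sum_(h < H) normc (a (n + h)%N) ^+ 2.
Proof.
move=> z1; apply: (le_trans (jensen_normc H (fun h => z ^+ h * a (n + h)%N))).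
rewrite le_eqVlt; apply/orP; left; apply/eqP; congr (_ * _).
by apply: eq_bigr => h _; rewrite Normc.normcM normc_unitX// mul1r.
Qed.

Lemma tavg_variance H z (c : C) n : (0 < H)%N -> normc z = 1 ->
  H%:R^-1 * \sum_(h < H) normc (z ^+ h * a (n + h)%N - c) ^+ 2 =
  H%:R^-1 * \sum_(h < H) normc (a (n + h)%N) ^+ 2 - normc (tavg H z a n) ^+ 2
    + normc (tavg H z a n - c) ^+ 2.
Proof.
move=> H0 z1.
have HN : H%:R != 0 :> R by rewrite pnatr_eq0 -lt0n.
rewrite (@variance_identity _ H (fun h => z ^+ h * a (n + h)%N) c (tavg H z a n)); last first.
  by rewrite /tavg mulVKf// pnatr_eq0 -lt0n.
have -> : \sum_(h < H) normc (z ^+ h * a (n + h)%N) ^+ 2 = \sum_(h < H) normc (a (n + h)%N) ^+ 2.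
  by apply: eq_bigr => h _; rewrite Normc.normcM normc_unitX// mul1r.
by field.
Qed.

End TwistedErgodic.

(** * Bounded measurable functions and the maximal ergodic theorem *)

Section BoundedMeasurable.
Context d (X : measurableType d) (R : realType).
Local Notation C := R[i].
Implicit Types (f g : X -> R) (F G : X -> C).

(** These functions form an algebra stable under composition with a measurable T, and they are
    integrable for a finite measure. *)
Definition bounded_measurable f :=
  measurable_fun setT f /\ exists K, forall x, `|f x| <= K.

Lemma bounded_measurableD f g : bounded_measurable f -> bounded_measurable g ->
  bounded_measurable (fun x => f x + g x).
Proof.
move=> [mf [K fK]] [mg [L gL]]; split; first exact: measurable_funD.
by exists (K + L) => x; rewrite (le_trans (ler_normD _ _))// lerD.
Qed.

Lemma bounded_measurableM f g : bounded_measurable f -> bounded_measurable g ->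
  bounded_measurable (fun x => f x * g x).
Proof.
move=> [mf [K fK]] [mg [L gL]]; split; first exact: measurable_funM.
by exists (K * L) => x; rewrite normrM ler_pM.
Qed.

Lemma bounded_measurable_cst (c : R) : bounded_measurable (fun=> c).
Proof. by split; [exact: measurable_cst | exists `|c|]. Qed.

Lemma bounded_measurableN f : bounded_measurable f ->
  bounded_measurable (fun x => - f x).
Proof.
move=> bf; under eq_fun do rewrite -mulN1r.
exact: bounded_measurableM (bounded_measurable_cst _) bf.
Qed.

Lemma bounded_measurableB f g : bounded_measurable f -> bounded_measurable g ->
  bounded_measurable (fun x => f x - g x).
Proof. by move=> bf bg; exact: bounded_measurableD bf (bounded_measurableN bg). Qed.

Lemma bounded_measurable_sum n (f : nat -> X -> R) :
  (forall i, bounded_measurable (f i)) ->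
  bounded_measurable (fun x => \sum_(i < n) f i x).
Proof.
move=> H; elim: n => [|n IH].
  by under eq_fun do rewrite big_ord0; exact: bounded_measurable_cst.
by under eq_fun do rewrite big_ord_recr/=; exact: bounded_measurableD.
Qed.

Lemma bounded_measurable_comp (T : X -> X) f : measurable_fun setT T ->
  bounded_measurable f -> bounded_measurable (fun x => f (T x)).
Proof.
by move=> mT [mf [K fK]]; split; [exact: measurableT_comp | exists K].
Qed.

Lemma bounded_measurable_indic (A : set X) : measurable A ->
  bounded_measurable (\1_A : X -> R).
Proof.
move=> mA; split; first exact: measurable_indic.
by exists 1 => x; rewrite indicE; case: (_ \in _); rewrite ?normr1 ?normr0.
Qed.

Lemma bounded_measurable_max0 f : bounded_measurable f ->
  bounded_measurable (fun x => Num.max 0 (f x)).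
Proof.
move=> [mf [K fK]]; split.
  by apply: measurable_maxr => //; exact: measurable_cst.
exists K => x; apply: le_trans (fK x).
by rewrite ger0_norm ?le_max ?lexx// ge_max normr_ge0 ler_norm.
Qed.

Definition cbounded_measurable F :=
  complex_measurable (F : X -> R[i]^o) /\ exists K, forall x, normc (F x) <= K.

Lemma cbounded_measurableP F : cbounded_measurable F <->
  bounded_measurable (fun x => complex.Re (F x)) /\
  bounded_measurable (fun x => complex.Im (F x)).
Proof.
split=> [[[mr mi] [K FK]]|[[mr [K rK]] [mi [L iL]]]].
  split; split=> //; exists K => x; apply: le_trans (FK x);
    [exact: normc_Re | exact: normc_Im].
split=> //; exists (K + L) => x.
exact: (le_trans (normc_le_ReIm _) (lerD (rK x) (iL x))).
Qed.

Lemma cbounded_measurableD F G : cbounded_measurable F -> cbounded_measurable G ->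
  cbounded_measurable (fun x => F x + G x).
Proof.
move=> /cbounded_measurableP[Fr Fi] /cbounded_measurableP[Gr Gi].
apply/cbounded_measurableP; split.
  by under eq_fun do rewrite cReD; exact: bounded_measurableD.
by under eq_fun do rewrite cImD; exact: bounded_measurableD.
Qed.

Lemma cbounded_measurableM F G : cbounded_measurable F -> cbounded_measurable G ->
  cbounded_measurable (fun x => F x * G x).
Proof.
move=> /cbounded_measurableP[Fr Fi] /cbounded_measurableP[Gr Gi].
apply/cbounded_measurableP; split.
  under eq_fun do rewrite cReM.
  by apply: bounded_measurableB; exact: bounded_measurableM.
under eq_fun do rewrite cImM.
by apply: bounded_measurableD; exact: bounded_measurableM.
Qed.

Lemma cbounded_measurable_cst (c : C) : cbounded_measurable (fun=> c).
Proof. by apply/cbounded_measurableP; split; exact: bounded_measurable_cst. Qed.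

Lemma cbounded_measurableB F G : cbounded_measurable F -> cbounded_measurable G ->
  cbounded_measurable (fun x => F x - G x).
Proof.
move=> bF bG; under eq_fun do rewrite -mulN1r.
apply: cbounded_measurableD bF _.
exact: cbounded_measurableM (cbounded_measurable_cst _) bG.
Qed.

Lemma cbounded_measurable_sum n (F : nat -> X -> C) :
  (forall i, cbounded_measurable (F i)) ->
  cbounded_measurable (fun x => \sum_(i < n) F i x).
Proof.
move=> H; elim: n => [|n IH].
  by under eq_fun do rewrite big_ord0; exact: cbounded_measurable_cst.
by under eq_fun do rewrite big_ord_recr/=; exact: cbounded_measurableD.
Qed.

Lemma cbounded_measurableX F n : cbounded_measurable F ->
  cbounded_measurable (fun x => F x ^+ n).
Proof.
move=> bF; elim: n => [|n IH].
  by under eq_fun do rewrite expr0; exact: cbounded_measurable_cst.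
by under eq_fun do rewrite exprS; exact: cbounded_measurableM.
Qed.

Lemma cbounded_measurable_comp (T : X -> X) F : measurable_fun setT T ->
  cbounded_measurable F -> cbounded_measurable (fun x => F (T x)).
Proof.
move=> mT /cbounded_measurableP[Fr Fi]; apply/cbounded_measurableP.
by split; [exact: (bounded_measurable_comp mT Fr) | exact: (bounded_measurable_comp mT Fi)].
Qed.

Lemma measurable_iter (T : X -> X) n : measurable_fun setT T ->
  measurable_fun setT (fun x => iter n T x).
Proof.
move=> mT; elim: n => [|n IH] /=; first exact: measurable_id.
exact: measurableT_comp.
Qed.

Lemma cbounded_measurable_iter (T : X -> X) F n : measurable_fun setT T ->
  cbounded_measurable F -> cbounded_measurable (fun x => F (iter n T x)).
Proof. by move=> mT; apply: cbounded_measurable_comp; exact: measurable_iter. Qed.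

Lemma cbounded_measurable_expi (t : X -> R) : measurable_fun setT t ->
  cbounded_measurable (fun x => expi (t x)).
Proof.
move=> mt; split; last by exists 1 => x; rewrite normc_expi.
split=> /=.
  by apply: measurableT_comp => //; apply: continuous_measurable_fun; exact: continuous_cos.
by apply: measurableT_comp => //; apply: continuous_measurable_fun; exact: continuous_sin.
Qed.

Lemma bounded_measurable_normc_sq F : cbounded_measurable F ->
  bounded_measurable (fun x => normc (F x) ^+ 2).
Proof.
move=> /cbounded_measurableP[Fr Fi]; under eq_fun do rewrite normc_sqr.
by apply: bounded_measurableD; under eq_fun do rewrite expr2; exact: bounded_measurableM.
Qed.

Lemma cbounded_measurable_indicM F (A : set X) : measurable A ->
  cbounded_measurable F -> cbounded_measurable (fun x => (\1_A x)%:C%C * F x).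
Proof.
move=> mA bF; apply: cbounded_measurableM bF; apply/cbounded_measurableP; split => /=.
  exact: bounded_measurable_indic.
exact: bounded_measurable_cst.
Qed.

End BoundedMeasurable.

(** * Integrals of bounded functions *)

Section BoundedIntegral.
Context d (X : measurableType d) (R : realType).
Variable mu : {finite_measure set X -> \bar R}.
Implicit Types (f g : X -> R).

Lemma bounded_measurable_integrable f : bounded_measurable f ->
  mu.-integrable setT (EFin \o f).
Proof.
move=> [mf [K fK]]; apply: measurable_bounded_integrable => //.
  by rewrite ltey_eq fin_num_measure.
exists K; split; first exact: num_real.
by move=> M KM x _ /=; exact: le_trans (fK x) (ltW KM).
Qed.

Lemma bintegralD f g : bounded_measurable f -> bounded_measurable g ->
  \int[mu]_x (f x + g x) = \int[mu]_x f x + \int[mu]_x g x.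
Proof.
by move=> /bounded_measurable_integrable bf /bounded_measurable_integrable bg;
  rewrite RintegralD.
Qed.

Lemma bintegralB f g : bounded_measurable f -> bounded_measurable g ->
  \int[mu]_x (f x - g x) = \int[mu]_x f x - \int[mu]_x g x.
Proof.
by move=> /bounded_measurable_integrable bf /bounded_measurable_integrable bg;
  rewrite RintegralB.
Qed.

Lemma bintegralZ f (c : R) : bounded_measurable f ->
  \int[mu]_x (c * f x) = c * \int[mu]_x f x.
Proof. by move=> /bounded_measurable_integrable bf; rewrite RintegralZl. Qed.

Lemma bintegral_sum n (f : nat -> X -> R) : (forall i, bounded_measurable (f i)) ->
  \int[mu]_x (\sum_(i < n) f i x) = \sum_(i < n) \int[mu]_x f i x.
Proof.
move=> bf; elim: n => [|n IH].
  under eq_Rintegral do rewrite big_ord0.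
  by rewrite big_ord0 Rintegral_cst// mul0r.
under eq_Rintegral do rewrite big_ord_recr/=.
rewrite big_ord_recr/= -IH; apply: bintegralD => //; exact: bounded_measurable_sum.
Qed.

Lemma le_bintegral f g : bounded_measurable f -> bounded_measurable g ->
  (forall x, f x <= g x) -> \int[mu]_x f x <= \int[mu]_x g x.
Proof.
by move=> /bounded_measurable_integrable bf /bounded_measurable_integrable bg fg;
  rewrite le_Rintegral.
Qed.

Lemma bintegral_cst (c : R) : \int[mu]_x c = c * fine (mu setT).
Proof. exact: Rintegral_cst. Qed.

Lemma bintegral_indic (A : set X) : measurable A -> \int[mu]_x \1_A x = fine (mu A).
Proof. by move=> mA; rewrite /Rintegral integral_indic// setIT. Qed.

Lemma bintegral_preserving (T : X -> X) f : measure_preserving mu T ->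
  bounded_measurable f -> \int[mu]_x f (T x) = \int[mu]_x f x.
Proof.
move=> [mT muT] bf; rewrite /Rintegral; congr fine.
have intf := bounded_measurable_integrable bf.
have bfT := bounded_measurable_integrable (bounded_measurable_comp mT bf).
have /= := @integral_pushforward _ _ _ _ _ _ mT mu setT (EFin \o f) _ _ measurableT.
rewrite preimage_setT => <-//; last by case/integrableP: intf.
by apply: eq_measure_integral => A mA _; rewrite -muT.
Qed.

Lemma bounded_cvg_bintegral (f : nat -> X -> R) (g : X -> R) (K : R) :
  (forall n, measurable_fun setT (f n)) -> measurable_fun setT g ->
  (forall n x, `|f n x| <= K) ->
  {ae mu, forall x, f n x @[n --> \oo] --> g x} ->
  \int[mu]_x f n x @[n --> \oo] --> \int[mu]_x g x.
Proof.
move=> mf mg fK fg.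
have [|||||ig _ cv] := @dominated_convergence _ _ _ mu setT measurableT
  (fun n => EFin \o f n) (EFin \o g) (fun=> K%:E).
- by move=> n; exact/measurable_EFinP.
- exact/measurable_EFinP.
- by apply: filterS fg => x fgx _; apply/cvg_EFin => //; exact: nearW.
- exact: (bounded_measurable_integrable (bounded_measurable_cst X K)).
- by apply: aeW => x n _ /=; rewrite lee_fin.
by apply: fine_cvg; rewrite fineK// integrable_fin_num.
Qed.

Lemma cvg_of_eventually_le (u : nat -> R) (l : R) :
  (forall e, 0 < e -> exists N0, forall n, (N0 <= n)%N -> `|u n - l| <= e) ->
  u n @[n --> \oo] --> l.
Proof.
move=> H; apply/cvgrPdist_le => e /H[N0 HN].
by exists N0 => // n /= /HN; rewrite distrC.
Qed.


Lemma bintegral0 : \int[mu]_x (0 : R) = 0.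
Proof. by rewrite bintegral_cst mul0r. Qed.

(** * The maximal ergodic theorem *)

Variable T : X -> X.
Hypothesis hT : measure_preserving mu T.

Let mT : measurable_fun setT T := hT.1.

(** This is the maximum over 0 <= k <= L of S_k(x) = h(x) + ... + h(T^(k-1) x), by the recursion
    S_(k+1)(x) = h(x) + S_k(Tx). *)
Fixpoint max_partial_sum (h : X -> R) L x : R :=
  if L is L'.+1 then Num.max 0 (h x + max_partial_sum h L' (T x)) else 0.

Lemma max_partial_sum_ge0 h L x : 0 <= max_partial_sum h L x.
Proof. by case: L => [|L] //=; rewrite le_max lexx. Qed.

Lemma max_partial_sumS h L x : max_partial_sum h L x <= max_partial_sum h L.+1 x.
Proof.
elim: L x => [|L IH] x; first exact: max_partial_sum_ge0.
rewrite [leRHS]/= [leLHS]/= ge_max le_max lexx/= le_max; apply/orP; right.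
by rewrite lerD2l; exact: IH.
Qed.

Lemma max_partial_sum_le h L M x : (L <= M)%N ->
  max_partial_sum h L x <= max_partial_sum h M x.
Proof.
elim: M => [|M IH]; first by rewrite leqn0 => /eqP ->.
rewrite leq_eqVlt => /orP[/eqP -> //|LM].
exact: le_trans (IH LM) (max_partial_sumS _ _ _).
Qed.

Lemma max_partial_sum_ge h L x :
  \sum_(k < L) h (iter k T x) <= max_partial_sum h L x.
Proof.
elim: L x => [|L IH] x; first by rewrite big_ord0.
rewrite big_ord_recl/= le_max; apply/orP; right; rewrite lerD2l.
apply: le_trans (IH _); rewrite le_eqVlt; apply/orP; left; apply/eqP.
by apply: eq_bigr => k _; rewrite -iterS iterSr.
Qed.

Lemma max_partial_sum_bounded h L : bounded_measurable h ->
  bounded_measurable (max_partial_sum h L).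
Proof.
move=> bh; elim: L => [|L IH] /=; first exact: bounded_measurable_cst.
apply: bounded_measurable_max0; apply: bounded_measurableD => //.
exact: (bounded_measurable_comp mT IH).
Qed.

(** Garsia's argument. Where M_(L+1) > 0 it equals h + M_L o T; elsewhere it is 0 <= M_L o T. So h
    cut off to the first set dominates M_(L+1) - M_L o T, whose integral is that of M_(L+1) - M_L >=
    0. As L grows, the sets capture every point with h different from 0. *)
Lemma maximal_ergodic h : bounded_measurable h ->
  (forall x, h x = 0 \/ exists n, 0 < \sum_(k < n) h (iter k T x)) ->
  0 <= \int[mu]_x h x.
Proof.
move=> bh Hh; pose M := max_partial_sum h.
have bM L : bounded_measurable (M L) by exact: max_partial_sum_bounded.
pose pos L := [set x | 0 < M L x].
have mpos L : measurable (pos L).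
  have := measurable_fun_ltr (measurable_cst (0 : R)) (bM L).1.
  by move/(_ measurableT [set true]); rewrite setTI; exact.
pose hL L x := h x * \1_(pos L) x.
have bhL L : bounded_measurable (hL L).
  by apply: bounded_measurableM => //; exact: bounded_measurable_indic.
have hL0 L : 0 <= \int[mu]_x hL L.+1 x.
  have bMT : bounded_measurable (fun x => M L (T x)).
    exact: (bounded_measurable_comp mT (bM L)).
  apply: (@le_trans _ _ (\int[mu]_x (M L.+1 x - M L (T x)))).
    rewrite bintegralB// bintegral_preserving// subr_ge0.
    by apply: le_bintegral => // x; exact: max_partial_sumS.
  apply: le_bintegral => //; first exact: bounded_measurableB.
  move=> x; rewrite /hL indicE /pos /M; have ML0 := max_partial_sum_ge0 h L (T x).
  have [xp|xp] := ltP 0 (max_partial_sum h L.+1 x).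
    rewrite mem_set// mulr1; move: xp => /=; rewrite /Num.max.
    by case: ifPn => [_ _|_]; [rewrite addrK | rewrite ltxx].
  rewrite memNset ?mulr0; first by rewrite subr_le0 (le_trans xp).
  by apply/negP; rewrite -leNgt.
have [K hK] := bh.2.
have cv : \int[mu]_x hL n.+1 x @[n --> \oo] --> \int[mu]_x h x.
  apply: (@bounded_cvg_bintegral _ _ K) => [n||n x|]; first exact: (bhL _).1.
  - exact: bh.1.
  - apply: le_trans (hK x); rewrite /hL normrM ler_piMr// indicE.
    by case: (_ \in _); rewrite ?normr1 ?normr0.
  apply: aeW => x; apply: cvg_of_eventually_le => e e0.
  have [hx0|[m mx]] := Hh x.
    by exists 0%N => n _; rewrite /hL hx0 mul0r subrr normr0 ltW.
  exists m => n mn; rewrite /hL indicE mem_set ?mulr1 ?subrr ?normr0 ?ltW//.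
  rewrite /pos/=; apply: lt_le_trans mx _; apply: le_trans (max_partial_sum_ge _ _ _) _.
  by apply: max_partial_sum_le; exact: leqW.
rewrite -(cvg_lim (@Rhausdorff R) cv); apply: limr_ge; first exact: cvgP cv.
by apply: nearW => n; exact: hL0.
Qed.

End BoundedIntegral.

(** * Eigenfunctions with an invariant eigenvalue *)

Section OrbitEnergy.
Context d (X : measurableType d) (R : realType).
Local Notation C := R[i].
Variable T : X -> X.
Hypothesis mT : measurable_fun setT T.

Definition orbit_seq (f : X -> C) (x : X) (n : nat) : C := f (iter n T x).

Lemma orbit_seqS f x : orbit_seq f (T x) = (fun n => orbit_seq f x n.+1).
Proof. by apply/funext => n; rewrite /orbit_seq -iterSr. Qed.

Lemma orbit_seq_iter f x n k : orbit_seq f (iter n T x) k = orbit_seq f x (n + k).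
Proof. by rewrite /orbit_seq addnC iterD. Qed.

Lemma tavg_orbit f x n H z :
  tavg H z (orbit_seq f (iter n T x)) 0 = tavg H z (orbit_seq f x) n.
Proof.
by rewrite /tavg; congr (_ * _); apply: eq_bigr => h _; rewrite orbit_seq_iter add0n.
Qed.

Lemma cbounded_measurable_tavg f t H n : cbounded_measurable f ->
  measurable_fun setT t ->
  cbounded_measurable (fun x => tavg H (expi (t x)) (orbit_seq f x) n).
Proof.
move=> bf mt; apply: cbounded_measurableM; first exact: cbounded_measurable_cst.
apply: (@cbounded_measurable_sum _ _ _ H
  (fun h x => expi (t x) ^+ h * orbit_seq f x (n + h))) => h.
apply: cbounded_measurableM; last exact: cbounded_measurable_iter.
by apply: cbounded_measurableX; exact: cbounded_measurable_expi.
Qed.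

Lemma measurable_limn_sup_bounded (u : nat -> X -> R) (B : R) :
  (forall n, measurable_fun setT (u n)) -> (forall n x, `|u n x| <= B) ->
  measurable_fun setT (fun x => limn_sup (u ^~ x)).
Proof.
move=> mu uB; have ub x := le_norm_bounded_fun (fun n => uB n x).
apply: measurable_fun_limn_sup => // x _;
  [exact: bounded_fun_has_ubound | exact: bounded_fun_has_lbound].
Qed.

Lemma measurable_energy (f : X -> C) (K : R) (t : X -> R) j :
  cbounded_measurable f -> (forall x, normc (f x) <= K) -> measurable_fun setT t ->
  measurable_fun setT (fun x => energy j (t x) (orbit_seq f x)).
Proof.
move=> bf fK mt.
apply: (@measurable_limn_sup_bounded
  (fun N x => mean_sq N (2 ^ j) (expi (t x)) (orbit_seq f x)) (K ^+ 2)) => [N|N x].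
  apply: (bounded_measurableM (bounded_measurable_cst _ _) _).1.
  apply: (@bounded_measurable_sum _ _ _ N
    (fun n x => normc (tavg (2 ^ j) (expi (t x)) (orbit_seq f x) n) ^+ 2)) => n.
  by apply: bounded_measurable_normc_sq; exact: cbounded_measurable_tavg.
apply: mean_sq_bound; [by move=> n; exact: fK | exact: normc_expi].
Qed.

Lemma measurable_first_above (q : X -> R -> R) e s :
  (forall t, measurable_fun setT (q ^~ t)) ->
  measurable_fun setT (fun x => first_above (q x) e s).
Proof.
move=> mq; elim: s => [|t s IH] /=; first exact: measurable_cst.
apply: measurable_fun_ifT; [|exact: measurable_cst|exact: IH].
by apply: measurable_fun_ler; [exact: measurable_cst|exact: mq].
Qed.

Lemma measurable_peak grid e (f : X -> C) (K : R) :
  (forall j t, t \in grid j -> `|t| <= 4) ->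
  cbounded_measurable f -> (forall x, normc (f x) <= K) ->
  measurable_fun setT (fun x => peak grid e (fun j t => energy j t (orbit_seq f x))).
Proof.
move=> g4 bf fK; apply: (@measurable_limn_sup_bounded _ 4) => [j|j x].
  apply: measurable_first_above => t.
  by apply: measurable_energy fK _ => //; exact: measurable_cst.
by apply: first_above_le => // t; exact: g4.
Qed.

Lemma energy_orbitT (f : X -> C) (K : R) x j t : (forall x, normc (f x) <= K) ->
  energy j t (orbit_seq f (T x)) = energy j t (orbit_seq f x).
Proof. by move=> fK; rewrite orbit_seqS; apply: energy_shift => n; exact: fK. Qed.

(* On [E], [t x] is an atom of mass at least [e] of the spectral measure of the
   orbit of x; off [E] there is no such atom. *)
Lemma peak_selection (f : X -> C) (K e : R) :
  cbounded_measurable f -> (forall x, normc (f x) <= K) ->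
  exists (t : X -> R) (E : set X),
  [/\ measurable_fun setT t, (forall x, t (T x) = t x),
      measurable E, (forall x, E (T x) = E x) &
      (forall x, E x -> forall j, e <= energy j (t x) (orbit_seq f x)) /\
      (forall x, ~ E x -> exists j, forall s, `|s| <= 4 -> energy j s (orbit_seq f x) < e)].
Proof.
move=> bf fK.
(* A point of X is what makes K nonnegative. *)
have [[x0]|X0] := pselect (exists x : X, True); last first.
  have no (x : X) : False by apply: X0; exists x.
  exists (fun=> 0), set0; by split => //; split => x; case: (no x).
have K0 : 0 <= K by exact: le_trans (normc_ge0 _) (fK x0).
have [grid [g4 Hg]] := energy_grids K0.
pose t x := peak grid e (fun j t => energy j t (orbit_seq f x)).
pose E := [set x | forall j, e <= energy j (t x) (orbit_seq f x)].
have mt : measurable_fun setT t by exact: measurable_peak fK.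
have tT x : t (T x) = t x.
  by rewrite /t; congr (peak _ _ _); apply/funext => j; apply/funext => s;
    rewrite (energy_orbitT _ _ _ fK).
exists t, E; split => //.
- rewrite [E](_ : _ = \bigcap_j [set x | e <= energy j (t x) (orbit_seq f x)]).
    apply: bigcap_measurable => // j _.
    have /(_ measurableT [set true]) := measurable_fun_ler (measurable_cst e)
      (measurable_energy j bf fK mt).
    by rewrite setTI; exact.
  by apply/seteqP; split => x Ex; [move=> j _; exact: Ex | move=> j; exact: Ex].
- move=> x; apply/propext; split => Ex j; have := Ex j; by rewrite tT (energy_orbitT _ _ _ fK).
- split=> // x nE; apply: contrapT => H; apply: nE => j.
  apply: (peak_energy g4 Hg) => [n|i]; first exact: fK.
  apply: contrapT => H'; apply: H; exists i => s s4.
  by rewrite ltNge; apply/negP => es; apply: H'; exists s.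
Qed.

End OrbitEnergy.

(** * Twisted averages in L^2 for an invariant angle *)

Section TwistedMeanErgodic.
Context d (X : measurableType d) (R : realType).
Local Notation C := R[i].
Variable mu : {finite_measure set X -> \bar R}.
Variable T : X -> X.
Hypothesis hT : measure_preserving mu T.
Variables (F : X -> C) (K : R) (t : X -> R).
Hypothesis bF : cbounded_measurable F.
Hypothesis FK : forall x, normc (F x) <= K.
Hypothesis K0 : 0 <= K.
Hypothesis mt : measurable_fun setT t.
Hypothesis tT : forall x, t (T x) = t x.

Let mT : measurable_fun setT T := hT.1.
Let orb x := orbit_seq T F x.
Let z x := expi (t x).
Let z1 x : normc (z x) = 1. Proof. exact: normc_expi. Qed.
Let orbK x n : normc (orb x n) <= K. Proof. exact: FK. Qed.

(** The u_j of the overview. Invariance of t makes u_j(T^n x) the window average starting at n, with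
    the same phase. *)
Definition dyadic_avg j x : C := tavg (2 ^ j) (expi (t x)) (orbit_seq T F x) 0.
Local Notation u := dyadic_avg.
Local Notation A j := (\int[mu]_x normc (u j x) ^+ 2).

Let tTn n x : t (iter n T x) = t x.
Proof. by elim: n => [//|n IH]; rewrite iterS tT. Qed.

Lemma dyadic_avg_iter j n x :
  u j (iter n T x) = tavg (2 ^ j) (z x) (orb x) n.
Proof. by rewrite /dyadic_avg tTn tavg_orbit. Qed.

Lemma dyadic_avg_le j x : normc (u j x) <= K.
Proof. exact: (tavg_le (orbK x) _ _ (z1 x)). Qed.

Lemma cbounded_dyadic_avg j : cbounded_measurable (u j).
Proof. exact: cbounded_measurable_tavg. Qed.

Let bu j : bounded_measurable (fun x => normc (u j x) ^+ 2).
Proof. by apply: bounded_measurable_normc_sq; exact: cbounded_dyadic_avg. Qed.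

Lemma bintegral_iter n f : bounded_measurable f ->
  \int[mu]_x f (iter n T x) = \int[mu]_x f x.
Proof.
move=> bf; elim: n => [//|n IH].
under eq_Rintegral do rewrite iterSr.
rewrite -IH (bintegral_preserving (f := fun x => f (iter n T x)) hT)//.
exact: (bounded_measurable_comp (measurable_iter _ mT) bf).
Qed.

Lemma bintegral_avg_iter H f : (0 < H)%N -> bounded_measurable f ->
  \int[mu]_x (H%:R^-1 * \sum_(h < H) f (iter h T x)) = \int[mu]_x f x.
Proof.
move=> H0 bf; have bfi i : bounded_measurable (fun x => f (iter i T x)).
  exact: (bounded_measurable_comp (measurable_iter _ mT) bf).
rewrite bintegralZ; last exact: (bounded_measurable_sum H bfi).
rewrite (bintegral_sum _ _ bfi).
under eq_bigr do rewrite bintegral_iter//.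
by rewrite sumr_const card_ord -[(\int[mu]_x f x) *+ _]mulr_natl mulKf// pnatr_eq0 -lt0n.
Qed.

(** u_(j+1) is half the sum of u_j and a rotated copy of u_j o T^(2^j), which has the same L^2
    norm. *)
Lemma dyadic_energy_anti i j : (i <= j)%N -> A j <= A i.
Proof.
elim: j => [|j IH]; first by rewrite leqn0 => /eqP ->.
rewrite leq_eqVlt => /orP[/eqP -> //|ij]; apply: le_trans (IH ij).
have bu' : bounded_measurable (fun x => normc (u j (iter (2 ^ j) T x)) ^+ 2).
  exact: (bounded_measurable_comp (measurable_iter _ mT) (bu j)).
have -> : A j = \int[mu]_x (2^-1 * (normc (u j x) ^+ 2 + normc (u j (iter (2 ^ j) T x)) ^+ 2)).
  rewrite bintegralZ; last exact: bounded_measurableD.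
  by rewrite bintegralD// (@bintegral_iter _ (fun x => normc (u j x) ^+ 2))//; field.
apply: le_bintegral => //.
  by apply: bounded_measurableM; [exact: bounded_measurable_cst | exact: bounded_measurableD].
move=> x; rewrite dyadic_avg_iter /dyadic_avg expnS tavg_double add0n -/(orb x) -/(z x).
move: (tavg _ _ (orb x) 0) (tavg _ _ (orb x) (2 ^ j)) => v w.
rewrite Normc.normcM normc_natV exprMn.
have := le_normcD v (z x ^+ (2 ^ j) * w); rewrite (Normc.normcM (z x ^+ _)) normc_unitX// mul1r.
have := normc_ge0 (v + z x ^+ (2 ^ j) * w).
have := sqr_ge0 (normc v - normc w).
move: (normc (_ + _)) (normc v) (normc w) => a b c; nra.
Qed.

(** A long twisted average of u_i + u_j is nearly 2 u_k, by [tavg_tavg], and averaging does not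
    increase the L^2 norm; so the norm of u_i + u_j is almost at least that of 2 u_k. With the
    parallelogram law this makes averages of nearly minimal energy close to each other. *)
Lemma dyadic_energy_sum i j (P : R) : (forall k, P <= A k) ->
  4 * P <= \int[mu]_x normc (u i x + u j x) ^+ 2.
Proof.
move=> PA; pose v x := u i x + u j x.
have bv : cbounded_measurable v.
  by apply: cbounded_measurableD; exact: cbounded_dyadic_avg.
have bv2 := bounded_measurable_normc_sq bv.
have muX : 0 <= fine (mu setT) by exact: fine_ge0.
apply/ler_addgt0Pr => e e0.
(* From 2|u_k| <= |w| + eta with |w| <= 2K and eta <= 1, squaring costs at most (4K + 1) eta at each
   point; M bounds the integrated cost and its summand 1 makes it positive. *)
pose M := (4 * K + 1) * fine (mu setT) + 1.
have c0 : 0 <= 4 * K + 1 by rewrite addr_ge0 // mulr_ge0.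
have M0 : 0 < M by rewrite /M ltr_wpDl// mulr_ge0.
pose eta := Num.min 1 (e / M).
have eta0 : 0 < eta by rewrite /eta lt_min ltr01 divr_gt0.
have eta1 : eta <= 1 by rewrite /eta ge_min lexx.
have etaM : eta * M <= e by rewrite -ler_pdivlMr// /eta ge_min lexx orbT.
have [k0 Hk] := eventually_div_le (2 * K * (2 ^ i + 2 ^ j)%:R) eta0.
have k2 : (k0 <= 2 ^ k0)%N by exact/ltnW/ltn_expl.
have := Hk _ k2; set H := (2 ^ k0)%N => HH.
have H0 : (0 < H)%N by rewrite expn_gt0.
have vorb x n : orbit_seq T v x n = tavg (2 ^ i) (z x) (orb x) n + tavg (2 ^ j) (z x) (orb x) n.
  by rewrite /orbit_seq /v !dyadic_avg_iter.
pose w x := tavg H (z x) (orbit_seq T v x) 0.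
have wE x : w x = tavg H (z x) (tavg (2 ^ i) (z x) (orb x)) 0 + tavg H (z x) (tavg (2 ^ j) (z x) (orb x)) 0.
  rewrite /w /tavg -mulrDr -big_split/=; congr (_ * _); apply: eq_bigr => h _.
  by rewrite vorb mulrDr.
have wu x : normc (w x - (u k0 x + u k0 x)) <= eta.
  apply: le_trans HH; rewrite wE opprD addrACA (le_trans (le_normcD _ _))//.
  rewrite natrD mulrDr mulrDl; apply: lerD; apply: tavg_tavg => //; rewrite ?expn_gt0//.
have v2K x : normc (v x) <= 2 * K.
  by rewrite (le_trans (le_normcD _ _))// mulr_natl mulr2n lerD// dyadic_avg_le.
have w2K x : normc (w x) <= 2 * K.
  by apply: tavg_le => // n; exact: v2K.
have bound x : 4 * normc (u k0 x) ^+ 2 <=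
    H%:R^-1 * (\sum_(h < H) normc (v (iter h T x)) ^+ 2) + (4 * K + 1) * eta.
  have H1 : normc (w x) ^+ 2 <= H%:R^-1 * \sum_(h < H) normc (v (iter h T x)) ^+ 2.
    exact: (tavg_sq_le (orbit_seq T v x) H 0 (z1 x)).
  have H2 : 2 * normc (u k0 x) <= normc (w x) + eta.
    have -> : 2 * normc (u k0 x) = normc (u k0 x + u k0 x).
      by rewrite -mulr2n normcMn mulr2n; ring.
    have := le_normcD (w x) (- (w x - (u k0 x + u k0 x))).
    by rewrite normcN opprB addrC subrK => /le_trans; apply; rewrite lerD2l.
  apply: (@le_trans _ _ (normc (w x) ^+ 2 + (4 * K + 1) * eta)); last by rewrite lerD2r.
  have := w2K x; have := normc_ge0 (u k0 x); have := normc_ge0 (w x); move: H2 eta0 eta1.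
  move: (normc (w x)) (normc (u k0 x)) => a b; nra.
have : 4 * A k0 <= \int[mu]_x normc (v x) ^+ 2 + (4 * K + 1) * eta * fine (mu setT).
  rewrite -bintegralZ// -(bintegral_avg_iter H0 bv2) -bintegral_cst -bintegralD.
  - apply: le_bintegral => //.
      by apply: bounded_measurableM => //; exact: bounded_measurable_cst.
    apply: bounded_measurableD; last exact: bounded_measurable_cst.
    apply: bounded_measurableM; first exact: bounded_measurable_cst.
    apply: (@bounded_measurable_sum _ _ _ H (fun h x => normc (v (iter h T x)) ^+ 2)) => h.
    exact: (bounded_measurable_comp (measurable_iter _ mT) bv2).
  - apply: bounded_measurableM; first exact: bounded_measurable_cst.
    apply: (@bounded_measurable_sum _ _ _ H (fun h x => normc (v (iter h T x)) ^+ 2)) => h.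
    exact: (bounded_measurable_comp (measurable_iter _ mT) bv2).
  - exact: bounded_measurable_cst.
rewrite -/(v _); have := PA k0; move: etaM; rewrite /M mulrDr mulr1.
have -> : eta * ((4 * K + 1) * fine (mu setT)) = (4 * K + 1) * eta * fine (mu setT) by ring.
rewrite /v; lra.
Qed.


(** P is the infimum of the energies; approaching it at rate 8^(-k) is fast enough for almost
    everywhere convergence. *)
Lemma dyadic_subsequence : exists (P : R) (s : nat -> nat),
  (forall k, P <= A k) /\ forall k, (k <= s k)%N /\ A (s k) <= P + 8^-1 ^+ k.
Proof.
pose P := inf (range (fun k => A k)).
have lbA : has_lbound (range (fun k => A k)).
  by exists 0 => _ [k _ <-]; apply: Rintegral_ge0 => x _; exact: sqr_ge0.
have PA k : P <= A k by apply: ge_inf => //; exists k.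
have pick k : exists j, (k <= j)%N /\ A j <= P + 8^-1 ^+ k.
  have [||_ [j _ <-] jP] := @inf_lt _ (range (fun k => A k)) (P + 8^-1 ^+ k).
  - by exists (A 0%N); exists 0%N.
  - by rewrite ltrDl exprn_gt0// invr_gt0.
  exists (maxn j k); split; first exact: leq_maxr.
  by apply: le_trans (ltW jP); apply: dyadic_energy_anti; exact: leq_maxl.
have [s Hs] := choice pick.
by exists P, s.
Qed.

End TwistedMeanErgodic.

(** * Almost everywhere bounds from summable integrals *)

Section SummableAE.
Context d (X : measurableType d) (R : realType).
Variable mu : {finite_measure set X -> \bar R}.

(** The sum of the series is integrable, hence finite almost everywhere, and there it bounds each of
    its nonnegative terms. *)
Lemma ae_bounded_of_summable (f : nat -> X -> R) (B : R) :
  (forall k, bounded_measurable (f k)) -> (forall k x, 0 <= f k x) ->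
  (forall n, \sum_(k < n) \int[mu]_x f k x <= B) ->
  {ae mu, forall x, exists M, forall k, f k x <= M}.
Proof.
move=> bf f0 fB.
pose g x := (\sum_(k <oo) (f k x)%:E)%E.
have mfk k : measurable_fun setT (fun x => (f k x)%:E).
  by apply/measurable_EFinP; exact: (bf k).1.
have g0 x : (0 <= g x)%E by apply: nneseries_ge0 => k _ _; rewrite lee_fin.
have mg : measurable_fun setT g.
  by apply: (ge0_emeasurable_sum (P := xpredT)) => // k x _ _; rewrite lee_fin.
have intg : mu.-integrable setT g.
  apply/integrableP; split => //.
  under eq_integral do rewrite gee0_abs//.
  rewrite integral_nneseries//; last by move=> k x _; rewrite lee_fin.
  apply: (@le_lt_trans _ _ B%:E); last exact: ltry.
  apply: lime_le; first by apply: is_cvg_nneseries => k _ _; apply: integral_ge0 => x _; rewrite lee_fin.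
  apply: nearW => n; rewrite big_mkord.
  have E k : (\int[mu]_x (f k x)%:E)%E = (\int[mu]_x f k x)%:E.
    rewrite /Rintegral fineK//; apply: integrable_fin_num => //.
    exact: bounded_measurable_integrable (bf k).
  by under eq_bigr do rewrite E; rewrite sumEFin lee_fin.
have := integrable_ae measurableT intg; apply: filterS => x /(_ I) gx.
exists (fine (g x)) => k; rewrite -lee_fin fineK//.
have H : (\sum_(0 <= i < k.+1) (f i x)%:E <= g x)%E.
  by apply: nneseries_lim_ge => i _ _; rewrite lee_fin.
apply: le_trans H; rewrite big_nat_recr//= leeDr//.
by rewrite sume_ge0// => i _; rewrite lee_fin.
Qed.

End SummableAE.

(** * Complex limit superior and geometric convergence *)

Section ComplexLimsup.
Variable R : realType.
Local Notation C := R[i].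

Lemma limn_sup_norm_le (u : nat -> R) B : (forall n, `|u n| <= B) -> `|limn_sup u| <= B.
Proof.
move=> uB; rewrite ler_norml; apply/andP; split.
  rewrite leNgt; apply/negP => /(limn_sup_lt uB)[N0 /(_ N0 (leqnn _))].
  by have := uB N0; rewrite ler_norml; lra.
by apply: (@limn_sup_le _ _ B _ 0) => // n _; have := uB n; rewrite ler_norml => /andP[].
Qed.

(** A total substitute for the limit: it is measurable in a parameter and equals the limit wherever
    that exists. *)
Definition climsup (v : nat -> C) : C :=
  (limn_sup (fun n => complex.Re (v n)) +i* limn_sup (fun n => complex.Im (v n)))%C.

Lemma climsup_ccvg (v : nat -> C) l : ccvg v l -> climsup v = l.
Proof.
move=> vl; rewrite /climsup.
have -> : limn_sup (fun n => complex.Re (v n)) = complex.Re l.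
  apply: (cvg_limn_inf_sup _).2; apply: cvg_of_eventually_le => e /vl[N0 HN].
  exists N0 => n /HN; apply: le_trans.
  by rewrite -cReN -cReD normc_Re.
have -> : limn_sup (fun n => complex.Im (v n)) = complex.Im l.
  apply: (cvg_limn_inf_sup _).2; apply: cvg_of_eventually_le => e /vl[N0 HN].
  exists N0 => n /HN; apply: le_trans.
  by rewrite -cImN -cImD normc_Im.
by case: l {vl}.
Qed.

Lemma cbounded_measurable_climsup d (X : measurableType d) (v : nat -> X -> C) (K : R) :
  (forall n, cbounded_measurable (v n)) -> (forall n x, normc (v n x) <= K) ->
  cbounded_measurable (fun x => climsup (v ^~ x)).
Proof.
move=> bv vK; apply/cbounded_measurableP.
have rK n x : `|complex.Re (v n x)| <= K by exact: le_trans (normc_Re _) (vK n x).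
have iK n x : `|complex.Im (v n x)| <= K by exact: le_trans (normc_Im _) (vK n x).
split; split => /=.
- by apply: (@measurable_limn_sup_bounded _ _ _ (fun n x => complex.Re (v n x)) K) => // n; exact: (bv n).1.1.
- by exists K => x; exact: limn_sup_norm_le.
- by apply: (@measurable_limn_sup_bounded _ _ _ (fun n x => complex.Im (v n x)) K) => // n; exact: (bv n).1.2.
- by exists K => x; exact: limn_sup_norm_le.
Qed.

Lemma ccvg_geometric (v : nat -> C) B :
  (forall k, normc (v k - v k.+1) <= B * 2^-1 ^+ k) -> exists l, ccvg v l.
Proof.
move=> H.
have B0 : 0 <= B by have := le_trans (normc_ge0 _) (H 0%N); rewrite expr0 mulr1.
(* The right side is the exact geometric sum, which lets the induction close. *)
have tele n m : normc (v n - v (n + m)%N) <= 2 * B * (2^-1 ^+ n - 2^-1 ^+ (n + m)).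
  elim: m => [|m IH]; first by rewrite addn0 !subrr Normc.normc0 mulr0.
  have -> : v n - v (n + m.+1)%N = (v n - v (n + m)%N) + (v (n + m)%N - v (n + m.+1)%N) by ring.
  apply: (le_trans (le_normcD _ _)); rewrite addnS; have := H (n + m)%N; rewrite [2^-1 ^+ (n + m).+1]exprS.
  by move: IH; lra.
apply: ccvg_cauchy => e e0.
have [N0 HN] := eventually_div_le (4 * B) e0.
have le0 n : (N0 <= n)%N -> normc (v N0 - v n) <= 2 * B * 2^-1 ^+ N0.
  move=> Nn; rewrite -(subnKC Nn); apply: (le_trans (tele _ _)).
  rewrite ler_wpM2l ?mulr_ge0//.
  by rewrite lerBlDr lerDl exprn_ge0.
have pw : 4 * B * 2^-1 ^+ N0 <= e.
  apply: le_trans (HN (2 ^ N0)%N _); last exact/ltnW/ltn_expl.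
  by rewrite natrX exprVn.
exists N0 => n m /le0 n0 /le0 m0.
have -> : v n - v m = - (v N0 - v n) + (v N0 - v m) by ring.
by apply: (le_trans (le_normcD _ _)); rewrite normcN; lra.
Qed.

End ComplexLimsup.

(** * The limiting eigenfunction *)

Section Eigenfunction.
Context d (X : measurableType d) (R : realType).
Local Notation C := R[i].
Variable mu : {finite_measure set X -> \bar R}.
Variable T : X -> X.
Hypothesis hT : measure_preserving mu T.
Variables (F : X -> C) (K : R) (t : X -> R).
Hypothesis bF : cbounded_measurable F.
Hypothesis FK : forall x, normc (F x) <= K.
Hypothesis K0 : 0 <= K.
Hypothesis mt : measurable_fun setT t.
Hypothesis tT : forall x, t (T x) = t x.

Let mT : measurable_fun setT T := hT.1.
Let orb x := orbit_seq T F x.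
Let z x := expi (t x).
Let z1 x : normc (z x) = 1. Proof. exact: normc_expi. Qed.
Let orbK x n : normc (orb x n) <= K. Proof. exact: FK. Qed.
Local Notation u := (dyadic_avg T F t).
Local Notation A j := (\int[mu]_x normc (u j x) ^+ 2).

Let bu j : cbounded_measurable (u j).
Proof. exact: (cbounded_dyadic_avg hT bF mt). Qed.

Let bu2 j : bounded_measurable (fun x => normc (u j x) ^+ 2).
Proof. exact: bounded_measurable_normc_sq. Qed.

(** Consecutive differences D_k along the subsequence satisfy ||D_k||^2 <= 4 * 8^(-k). So the
    functions 4^k |D_k|^2 have summable integrals and are bounded in k almost everywhere: |D_k|
    decays like 2^(-k). *)
Lemma dyadic_limit_exists : exists (c : X -> C) (s : nat -> nat),
  [/\ cbounded_measurable c, (forall k, (k <= s k)%N),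
      (forall x l, ccvg (fun k => u (s k) x) l -> c x = l) &
      {ae mu, forall x, exists l, ccvg (fun k => u (s k) x) l}].
Proof.
have [P [s [PA Hs]]] := dyadic_subsequence hT bF mt tT.
exists (fun x => climsup (fun k => u (s k) x)), s; split.
- apply: (@cbounded_measurable_climsup _ _ _ (fun k => u (s k)) K) => // n x.
  exact: (@dyadic_avg_le _ _ _ T F K t FK).
- by move=> k; exact: (Hs k).1.
- by move=> x l; exact: climsup_ccvg.
pose D k x := u (s k) x - u (s k.+1) x.
have bD k : bounded_measurable (fun x => normc (D k x) ^+ 2).
  by apply: bounded_measurable_normc_sq; exact: cbounded_measurableB.
have intD k : \int[mu]_x normc (D k x) ^+ 2 <= 4 * 8^-1 ^+ k.
  have := dyadic_energy_sum hT bF FK K0 mt tT (s k) (s k.+1) PA.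
  (* The parallelogram law; the sum term is at least 4P, while each energy exceeds P by at most its
     power of 1/8. *)
  have : \int[mu]_x normc (D k x) ^+ 2 + \int[mu]_x normc (u (s k) x + u (s k.+1) x) ^+ 2 =
      2 * A (s k) + 2 * A (s k.+1).
    have b2 j : bounded_measurable (fun x => 2 * normc (u j x) ^+ 2).
      by apply: bounded_measurableM => //; exact: bounded_measurable_cst.
    rewrite -!bintegralZ// -!bintegralD//; last first.
      by apply: bounded_measurable_normc_sq; exact: cbounded_measurableD.
    apply: eq_Rintegral => x _; rewrite !normc_sqr !cReD !cImD !cReN !cImN; ring.
  have := (Hs k).2; have := (Hs k.+1).2; rewrite exprS.
  have : 0 <= 8^-1 ^+ k :> R by rewrite exprn_ge0// invr_ge0.
  set p := 8^-1 ^+ k; lra.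
suff : {ae mu, forall x, exists M, forall k, 4 ^+ k * normc (D k x) ^+ 2 <= M}.
  (* M + 1 stands in for a square root of M, as M <= (M + 1)^2. *)
  apply: filterS => x [M HM]; apply: (@ccvg_geometric _ _ (M + 1)) => k.
  have M0 : 0 <= M.
    by apply: le_trans (HM 0%N); rewrite mulr_ge0 ?sqr_ge0// exprn_ge0.
  rewrite -/(D k x); apply: normc_le_sqrP; first by rewrite mulr_ge0// ?exprn_ge0 ?invr_ge0// addr_ge0.
  have := HM k.
  have -> : ((M + 1) * 2^-1 ^+ k) ^+ 2 = (M + 1) ^+ 2 * (4 ^+ k)^-1.
    by rewrite exprMn -exprM mulnC exprM -exprVn; congr (_ * _ ^+ _); field.
  rewrite ler_pdivlMr ?exprn_gt0// mulrC => /le_trans; apply; nra.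
apply: (@ae_bounded_of_summable _ _ _ mu (fun k x => 4 ^+ k * normc (D k x) ^+ 2) 8) => [k|k x|n].
- by apply: bounded_measurableM => //; exact: bounded_measurable_cst.
- by rewrite mulr_ge0 ?sqr_ge0// exprn_ge0.
- have : \sum_(k < n) \int[mu]_x (4 ^+ k * normc (D k x) ^+ 2) <= 8 - 8 * 2^-1 ^+ n.
    elim: n => [|n IH]; first by rewrite big_ord0 expr0 mulr1 subrr.
    rewrite big_ord_recr/= bintegralZ//.
    have : 4 ^+ n * \int[mu]_x normc (D n x) ^+ 2 <= 4 * 2^-1 ^+ n.
      apply: (le_trans (ler_wpM2l _ (intD n))); first by rewrite exprn_ge0.
      rewrite mulrCA -exprMn; have -> : 4 * 8^-1 = 2^-1 :> R by field.
      by [].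
    rewrite exprS; move: IH; lra.
  by move=> /le_trans; apply; rewrite lerBlDr lerDl mulr_ge0// exprn_ge0// invr_ge0.
Qed.

Variables (c : X -> C) (s : nat -> nat).
Hypothesis bc : cbounded_measurable c.
Hypothesis s_ge : forall k, (k <= s k)%N.
Hypothesis cE : forall x l, ccvg (fun k => u (s k) x) l -> c x = l.
Hypothesis cv : {ae mu, forall x, exists l, ccvg (fun k => u (s k) x) l}.

(** By [tavg_shift], with error 2 K / 2^(s k), convergence at x propagates to the whole orbit of x,
    each step multiplying the limit by z^(-1). *)
Lemma dyadic_limit_eigen x : (exists l, ccvg (fun k => u (s k) x) l) ->
  forall n, c (iter n T x) = c x * (z x)^-1 ^+ n.
Proof.
move=> [l ul]; rewrite (cE ul) => n; apply: cE.
suff H : ccvg (fun k => tavg (2 ^ s k) (z x) (orb x) n) (l * (z x)^-1 ^+ n).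
  move=> e /H[N0 HN]; exists N0 => k /HN.
  by rewrite (dyadic_avg_iter F tT).
have zx0 : z x != 0 by exact: normc1_neq0.
elim: n => [|n IH]; first by rewrite expr0 mulr1.
move=> e e0; have e2 : 0 < e / 2 by lra.
have [N1 H1] := IH _ e2; have [N2 H2] := eventually_div_le (2 * K) e2.
exists (maxn N1 N2) => k; rewrite geq_max => /andP[/H1 k1 kN2].
have := tavg_shift (orbK x) n (_ : (0 < 2 ^ s k)%N) (z1 x); rewrite expn_gt0 => /(_ isT) k3.
have := H2 (2 ^ s k)%N (leq_trans (leq_trans kN2 (s_ge k)) (ltnW (ltn_expl (s k) (ltnSn 1)))) => k2.
set v := tavg _ _ _ n.+1 in k3 *; set v' := tavg _ _ _ n in k1 k3.
have -> : normc (v - l * (z x)^-1 ^+ n.+1) = normc (z x * v - l * (z x)^-1 ^+ n).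
  rewrite -[LHS]mul1r -(z1 x) -Normc.normcM mulrBr; congr (normc (_ - _)).
  by rewrite exprS mulrCA mulVKf.
have -> : z x * v - l * (z x)^-1 ^+ n = (z x * v - v') + (v' - l * (z x)^-1 ^+ n) by ring.
apply: (le_trans (le_normcD _ _)); rewrite [leRHS](splitr e) lerD//.
exact: le_trans k3 k2.
Qed.

Lemma bintegral_ae_eq (f g : X -> R) : bounded_measurable f -> bounded_measurable g ->
  {ae mu, forall x, f x = g x} -> \int[mu]_x f x = \int[mu]_x g x.
Proof.
move=> bf bg fg; rewrite /Rintegral; congr fine.
apply: ae_eq_integral => //.
- by apply/measurable_EFinP; exact: bf.1.
- by apply/measurable_EFinP; exact: bg.1.
- by apply: filterS fg => x -> .
Qed.

(** Since c(T^h x) = z^(-h) c(x), integrating the variance identity gives ||F - c||^2 = ||F||^2 -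
    ||u_j||^2 + ||u_j - c||^2 for every j. The last term tends to 0 along the subsequence. *)
Lemma dyadic_limit_energy (B : R) : (forall j, B <= A j) ->
  \int[mu]_x normc (F x - c x) ^+ 2 <= \int[mu]_x normc (F x) ^+ 2 - B.
Proof.
move=> BA.
have bFc : bounded_measurable (fun x => normc (F x - c x) ^+ 2).
  by apply: bounded_measurable_normc_sq; exact: cbounded_measurableB.
have buc j : bounded_measurable (fun x => normc (u j x - c x) ^+ 2).
  by apply: bounded_measurable_normc_sq; exact: cbounded_measurableB.
have bF2 := bounded_measurable_normc_sq bF.
have bF2i h : bounded_measurable (fun x => normc (F (iter h T x)) ^+ 2).
  exact: (bounded_measurable_comp (measurable_iter h mT) bF2).
have bFci h : bounded_measurable (fun x => normc (F (iter h T x) - c (iter h T x)) ^+ 2).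
  exact: (bounded_measurable_comp (measurable_iter h mT) bFc).
have bavg H (f : nat -> X -> R) : (forall h, bounded_measurable (f h)) ->
    bounded_measurable (fun x => H%:R^-1 * \sum_(h < H) f h x).
  move=> bf; apply: bounded_measurableM; first exact: bounded_measurable_cst.
  exact: bounded_measurable_sum.
have E j : \int[mu]_x normc (F x - c x) ^+ 2 =
    \int[mu]_x normc (F x) ^+ 2 - A j + \int[mu]_x normc (u j x - c x) ^+ 2.
  have H0 : (0 < 2 ^ j)%N by rewrite expn_gt0.
  rewrite -(bintegral_avg_iter hT H0 bFc) -(bintegral_avg_iter hT H0 bF2).
  have bF2a := bavg (2 ^ j)%N _ bF2i.
  rewrite -bintegralB// -bintegralD//; last exact: bounded_measurableB.
  apply: bintegral_ae_eq.
  - exact: (bavg (2 ^ j)%N _ bFci).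
  - by apply: bounded_measurableD => //; exact: bounded_measurableB.
  apply: filterS cv => x ux.
  rewrite -(tavg_variance (orb x) (c x) 0 H0 (z1 x)).
  congr (_ * _); apply: eq_bigr => h _; congr (_ ^+ 2).
  rewrite (dyadic_limit_eigen ux) add0n -[LHS]mul1r -(normc_unitX h (z1 x)) -Normc.normcM.
  congr normc; rewrite mulrBr; congr (_ - _).
  by rewrite mulrCA -exprMn divff ?normc1_neq0// expr1n mulr1.
have [Kc Hc] := bc.2.
have lim0 : \int[mu]_x normc (u (s k) x - c x) ^+ 2 @[k --> \oo] --> 0.
  rewrite -(bintegral0 mu).
  apply: (@bounded_cvg_bintegral _ _ _ mu _ _ ((K + Kc) ^+ 2)) => [k||k x|].
  - exact: (buc _).1.
  - exact: measurable_cst.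
  - have uc : normc (u (s k) x - c x) <= K + Kc.
      rewrite (le_trans (le_normcD _ _))// normcN lerD//.
      exact: (@dyadic_avg_le _ _ _ T F K t FK).
    by rewrite ger0_norm ?sqr_ge0// ler_pXn2r ?nnegrE ?normc_ge0 ?(le_trans (normc_ge0 _) uc).
  apply: filterS cv => x [l ul]; rewrite (cE ul).
  apply: cvg_of_eventually_le => e e0.
  (* A distance of at most min(1, e) has a square of at most e. *)
  pose e' := Num.min 1 e.
  have e'0 : 0 < e' by rewrite lt_min ltr01.
  have e'1 : e' <= 1 by rewrite ge_min lexx.
  have e'e : e' <= e by rewrite ge_min lexx orbT.
  have [N0 HN] := ul _ e'0; exists N0 => k /HN uk.
  rewrite subr0 ger0_norm ?sqr_ge0//; have := normc_ge0 (u (s k) x - l).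
  move: (normc _) uk => a; nra.
have cvF : \int[mu]_x normc (F x) ^+ 2 - B + \int[mu]_x normc (u (s k) x - c x) ^+ 2
    @[k --> \oo] --> \int[mu]_x normc (F x) ^+ 2 - B + 0.
  by apply: cvgD lim0; exact: cvg_cst.
rewrite -[leRHS]addr0 -(cvg_lim (@Rhausdorff R) cvF).
apply: limr_ge; first exact: cvgP cvF.
by apply: nearW => k; rewrite (E (s k)) lerD2r lerD2l lerN2.
Qed.

End Eigenfunction.

(** * Uniform Wiener-Wintner theorem *)

Section WienerWintner.
Context d (X : measurableType d) (R : realType).
Local Notation C := R[i].
Variable mu : {finite_measure set X -> \bar R}.
Variable T : X -> X.
Hypothesis hT : measure_preserving mu T.
Let mT : measurable_fun setT T := hT.1.

(** One subtraction of the overview, with e in the place of e^2. Cutting f off to E confines c to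
    the points where the selected angle carries energy. *)
Lemma eigen_step (f : X -> C) (e : R) : cbounded_measurable f -> 0 < e ->
  exists (c : X -> C) (E : set X),
  [/\ cbounded_measurable c, measurable E,
   (forall x, ~ E x -> exists j, forall s, `|s| <= 4 -> energy j s (orbit_seq T f x) < e),
   {ae mu, forall x, exists2 l, normc l = 1 & forall n, c (iter n T x) = c x * l ^+ n} &
   \int[mu]_x normc (f x - c x) ^+ 2 <=
     \int[mu]_x normc (f x) ^+ 2 - e / 2 * fine (mu E)].
Proof.
move=> bf e0; have [K' HK'] := bf.2; pose K := `|K'|.
have fK x : normc (f x) <= K by exact: le_trans (HK' x) (ler_norm _).
have K0 : 0 <= K by exact: normr_ge0.
have [t [E [mt tT mE ET [Ein Eout]]]] := peak_selection mT e bf fK.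
pose F x : C := (\1_E x)%:C%C * f x.
have bF : cbounded_measurable F by exact: cbounded_measurable_indicM.
have FE x : E x -> F x = f x by move=> Ex; rewrite /F indicE mem_set// mul1r.
have FnE x : ~ E x -> F x = 0 by move=> Ex; rewrite /F indicE memNset// mul0r.
have FK x : normc (F x) <= K.
  by have [/FE ->//|/FnE ->] := pselect (E x); rewrite Normc.normc0.
have Eiter n x : E (iter n T x) = E x by elim: n => [//|n IH]; rewrite iterS ET.
have orbE x : E x -> orbit_seq T F x = orbit_seq T f x.
  by move=> Ex; apply/funext => n; rewrite /orbit_seq FE// Eiter.
have bu j : cbounded_measurable (dyadic_avg T F t j) := cbounded_dyadic_avg hT bF mt j.
have u0 x j : ~ E x -> dyadic_avg T F t j x = 0.
  move=> nE; rewrite /dyadic_avg /tavg big1 ?mulr0// => h _.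
  by rewrite /orbit_seq FnE ?mulr0// Eiter.
have energy_ge j : e / 2 * fine (mu E) <= \int[mu]_x normc (dyadic_avg T F t j x) ^+ 2.
  have bu2 := bounded_measurable_normc_sq (bu j).
  have b1 := bounded_measurable_indic R mE.
  (* The maximal ergodic theorem is applied to this function. It vanishes off E; on E the limit
     superior of the means of |u_j|^2 is at least e, and e / 2 leaves room for a strictly positive
     partial sum, of length at least 1. *)
  have bh : bounded_measurable (fun x => \1_E x * (normc (dyadic_avg T F t j x) ^+ 2 - e / 2)).
    apply: bounded_measurableM => //; apply: bounded_measurableB => //.
    exact: bounded_measurable_cst.
  have := maximal_ergodic hT bh.
  have -> : \int[mu]_x (\1_E x * (normc (dyadic_avg T F t j x) ^+ 2 - e / 2)) =
      \int[mu]_x normc (dyadic_avg T F t j x) ^+ 2 - e / 2 * fine (mu E).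
    rewrite -bintegral_indic// -bintegralZ// -bintegralB//; last first.
      by apply: bounded_measurableM => //; exact: bounded_measurable_cst.
    apply: eq_Rintegral => x _; rewrite indicE.
    have [Ex|nE] := pselect (E x); first by rewrite mem_set// mul1r mulr1.
    by rewrite memNset// mul0r mulr0 u0// Normc.normc0 expr0n subr0.
  rewrite subr_ge0; apply => x; have [Ex|nE] := pselect (E x); last first.
    by left; rewrite indicE memNset// mul0r.
  right.
  have [||N N1] := @lt_limn_sup_freq _ (fun N => mean_sq N (2 ^ j) (expi (t x)) (orbit_seq T f x))
     (K ^+ 2) (e / 2) _ _ 1.
  - by move=> N; apply: mean_sq_bound; [move=> n; exact: fK | exact: normc_expi].
  - by apply: lt_le_trans (Ein x Ex j); lra.
  rewrite /mean_sq [_^-1 * _]mulrC ltr_pdivlMr ?ltr0n// => H; exists N.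
  have -> : \sum_(k < N) \1_E (iter k T x) * (normc (dyadic_avg T F t j (iter k T x)) ^+ 2 - e / 2) =
      \sum_(k < N) normc (tavg (2 ^ j) (expi (t x)) (orbit_seq T f x) k) ^+ 2 - e / 2 * N%:R.
    have -> : e / 2 * N%:R = \sum_(k < N) e / 2 by rewrite sumr_const card_ord mulr_natr.
    rewrite -sumrB.
    apply: eq_bigr => k _; rewrite indicE mem_set ?Eiter// mul1r.
    by rewrite (dyadic_avg_iter F tT) orbE.
  by rewrite subr_gt0.
have [c [s [bc s_ge cE cv]]] := dyadic_limit_exists hT bF FK K0 mt tT.
exists c, E; split => //.
- apply: filterS cv => x ux; exists (expi (t x))^-1.
    by rewrite Normc.normcV normc_expi invr1.
  exact: (dyadic_limit_eigen FK tT s_ge cE ux).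
- have := dyadic_limit_energy hT bF FK mt tT bc s_ge cE cv energy_ge.
  have bFc := bounded_measurable_normc_sq (cbounded_measurableB bF bc).
  have bfc := bounded_measurable_normc_sq (cbounded_measurableB bf bc).
  have bF2 := bounded_measurable_normc_sq bF.
  have bf2 := bounded_measurable_normc_sq bf.
  (* Pointwise identity: F = f on E, and both F and c vanish off E. It transfers the decrease from F
     to f. *)
  have : \int[mu]_x normc (f x - c x) ^+ 2 + \int[mu]_x normc (F x) ^+ 2 =
         \int[mu]_x normc (F x - c x) ^+ 2 + \int[mu]_x normc (f x) ^+ 2.
    rewrite -!bintegralD//; apply: eq_Rintegral => x _.
    have [Ex|nE] := pselect (E x); first by rewrite FE// addrC.
    have -> : c x = 0.
      apply: cE => d0 d0'; exists 0%N => k _.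
      by rewrite u0// subrr Normc.normc0 ltW.
    by rewrite FnE// !subr0 addrC.
  lra.
Qed.

(** n bounds the number of subtractions: as long as mu(E) >= del, each lowers ||f||^2 by at least e
    / 2 * del. For n = 0 the hypothesis would make ||f||^2 negative. *)
Lemma eigen_decomposition n (f : X -> C) (e del : R) : 0 < e -> 0 < del ->
  cbounded_measurable f -> \int[mu]_x normc (f x) ^+ 2 < n%:R * (e / 2 * del) ->
  exists E : set X, [/\ measurable E, fine (mu E) < del &
   {ae mu, forall x, ~ E x -> exists2 s, unimodular s & exists j, forall t, `|t| <= 4 ->
     energy j t (fun k => orbit_seq T f x k - exp_sum s k) < e}].
Proof.
move=> e0 del0; elim: n f => [|n IH] f bf.
  by rewrite mul0r ltNge Rintegral_ge0// => x _; exact: sqr_ge0.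
move=> fn; have [c [E [bc mE Eout cae fc]]] := eigen_step bf e0.
have [Edel|Edel] := ltP (fine (mu E)) del.
  exists E; split => //; apply: aeW => x /Eout[j Hj]; exists [::] => //; exists j => t.
  have -> : (fun k => orbit_seq T f x k - exp_sum [::] k) = orbit_seq T f x.
    by apply/funext => k; rewrite /exp_sum big_nil subr0.
  exact: Hj.
have [||E' [mE' E'del Eae]] := IH (fun x => f x - c x).
- exact: cbounded_measurableB.
- apply: (le_lt_trans fc); rewrite ltrBlDr (lt_le_trans fn)//.
  by rewrite -natr1 mulrDl mul1r lerD2l ler_wpM2l// divr_ge0// ltW.
exists E'; split => //; apply: filterS2 Eae cae => x Hx [l l1 cl] /Hx[s us [j Hj]].
(* Along the orbit of x the subtracted function is the single exponential c(x) l^k. *)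
exists ((c x, l) :: s).
  by move=> p; rewrite inE => /predU1P[->//|]; exact: us.
exists j => t /Hj; congr (energy _ _ _ < _); apply/funext => k.
by rewrite /exp_sum big_cons/= /orbit_seq cl opprD addrA.
Qed.

Lemma exp_sum_bounded (s : seq (C * C)) : unimodular s -> bounded_seq (exp_sum s).
Proof.
move=> us; exists (\sum_(p <- s) normc p.1); first by apply: sumr_ge0 => p _; exact: normc_ge0.
move=> n; apply: (le_trans (normc_sum _ _)); rewrite !big_seq; apply: ler_sum => p /us p1.
by rewrite Normc.normcM normc_unitX// mulr1.
Qed.

(** Joining its null set to each E covers the points where [P] fails by measurable sets of measure
    below 1 / (k + 1); their intersection is null. *)
Lemma ae_of_small_sets (P : X -> Prop) :
  (forall del : R, 0 < del -> exists E : set X, [/\ measurable E, fine (mu E) < del &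
     {ae mu, forall x, ~ E x -> P x}]) -> {ae mu, forall x, P x}.
Proof.
move=> H; have pos k : 0 < k.+1%:R^-1 :> R by rewrite invr_gt0.
have step k : exists N : set X, [/\ measurable N, fine (mu N) < k.+1%:R^-1 &
    forall x, ~ P x -> N x].
  have [E [mE Ek [N [mN N0 HN]]]] := H _ (pos k).
  exists (E `|` N); split; first exact: measurableU.
    by rewrite measureU0.
  move=> x nP; have [Ex|nE] := pselect (E x); first by left.
  by right; apply: HN => /(_ nE).
have [N HN] := choice step.
exists (\bigcap_k N k); split.
- by apply: bigcap_measurable => // k _; have [] := HN k.
- have mI : measurable (\bigcap_k N k) by apply: bigcap_measurable => // k _; have [] := HN k.
  have fI : mu (\bigcap_k N k) \is a fin_num by exact: fin_num_measure.
  rewrite -(fineK fI); congr (_%:E); apply/eqP; rewrite eq_le fine_ge0// andbT.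
  rewrite leNgt; apply/negP => I0.
  have [k0 Hk] := eventually_div_le 1 (divr_gt0 I0 (ltr0n R 2)).
  have := Hk k0.+1 (leqnSn _); rewrite mul1r => Hk'.
  have [mN Nk _] := HN k0.
  have : fine (mu (\bigcap_k N k)) <= fine (mu (N k0)).
    by rewrite fine_le ?fin_num_measure// le_measure ?inE//; exact: bigcap_inf.
  move=> /le_lt_trans/(_ Nk)/lt_le_trans/(_ Hk').
  by rewrite ltNge ler_pdivrMr// ler_peMr ?ler1n// ltW.
- by move=> x nP k _; have [_ _] := HN k; apply.
Qed.

(** For each tolerance 1 / (m + 1), [eigen_decomposition] leaves small energy off a set of
    arbitrarily small measure, hence small twisted sums almost everywhere. Countably many m
    suffice. *)
Lemma ae_ww_sequence (f : X -> C) : cbounded_measurable f ->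
  {ae mu, forall x, ww_sequence (orbit_seq T f x)}.
Proof.
move=> bf; have [K HK] := bf.2.
suff H m : {ae mu, forall x, exists2 s : seq (C * C), unimodular s & exists N0, forall N, (N0 <= N)%N ->
    forall z, normc z = 1 -> normc (\sum_(n < N) z ^+ n * (orbit_seq T f x n - exp_sum s n)) <=
      N%:R * (3 * m.+1%:R^-1)}.
  have := ae_foralln H; apply: filterS => x Hx e e0.
  have [m Hm] := eventually_div_le 3 e0.
  have [s us [N0 HN]] := Hx m; exists s => //; exists N0 => N NN z z1.
  by apply: (le_trans (HN N NN z z1)); rewrite ler_wpM2l// Hm.
have e0 : 0 < m.+1%:R^-1 :> R by rewrite invr_gt0.
have e20 : 0 < m.+1%:R^-1 ^+ 2 :> R by rewrite exprn_gt0.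
apply: ae_of_small_sets => del del0.
have [n fn] : exists n : nat, \int[mu]_x normc (f x) ^+ 2 < n%:R * (m.+1%:R^-1 ^+ 2 / 2 * del).
  exists (Num.truncn (\int[mu]_x normc (f x) ^+ 2 / (m.+1%:R^-1 ^+ 2 / 2 * del))).+1.
  by rewrite -ltr_pdivrMr ?truncnS_gt// mulr_gt0// divr_gt0.
have [E [mE Ed Eae]] := eigen_decomposition e20 del0 bf fn.
exists E; split => //; apply: filterS Eae => x Hx /Hx[s us [j Hj]].
have [L L0 HL] := exp_sum_bounded us.
exists s => //; apply: (@small_energy_twisted_sum _ (fun n => orbit_seq T f x n - exp_sum s n) (K + L) _ j) => // k.
by rewrite (le_trans (le_normcD _ _))// normcN lerD// HK.
Qed.

End WienerWintner.

(** * Almost everywhere and norm convergence *)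

Section L2.
Context d (X : measurableType d) (R : realType).
Local Notation C := R[i].
Variable mu : {finite_measure set X -> \bar R}.

Lemma L2normE (h : X -> C) : cbounded_measurable h ->
  L2norm mu (h : X -> R[i]^o) = (Num.sqrt (\int[mu]_x normc (h x) ^+ 2))%:E.
Proof.
move=> bh; rewrite /L2norm unlock.
have bh2 := bounded_measurable_normc_sq bh.
have -> : (\int[mu]_x (`|(EFin \o (fun x => normc (h x))) x| `^ 2) =
    (\int[mu]_x normc (h x) ^+ 2)%:E)%E.
  rewrite /Rintegral fineK; last first.
    by apply: integrable_fin_num => //; exact: bounded_measurable_integrable bh2.
  apply: eq_integral => x _ /=.
  by rewrite (ger0_norm (normc_ge0 (h x))) powR_mulrn ?normc_ge0.
rewrite poweR_EFin powR12_sqrt//.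
by apply: Rintegral_ge0 => x _; exact: sqr_ge0.
Qed.

(** Dominated convergence for the squared distance to the limit superior [g], with a constant as the
    dominating function. *)
Lemma ae_cvg_in_L2 (u : nat -> X -> C) (K : R) :
  (forall n, cbounded_measurable (u n)) -> (forall n x, normc (u n x) <= K) ->
  {ae mu, forall x, exists l, ccvg (u ^~ x) l} -> cvg_in_L2 mu (u : nat -> X -> R[i]^o).
Proof.
move=> bu uK cu; pose g x := climsup (u ^~ x).
have bg : cbounded_measurable g by exact: cbounded_measurable_climsup bu uK.
have [L gL] := bg.2.
have bug n : cbounded_measurable (fun x => u n x - g x) by exact: cbounded_measurableB.
exists g; split; first exact: bg.1.
  by rewrite L2normE// ltry.
have -> : (fun N => L2norm mu (fun x => (u N x - g x : R[i]^o))) =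
    (fun N => (Num.sqrt (\int[mu]_x normc (u N x - g x) ^+ 2))%:E).
  by apply/funext => N; exact: L2normE.
apply: cvg_EFin; first exact: nearW.
rewrite -[X in _ --> X](@sqrtr0 R).
apply: (@continuous_cvg _ _ _ _ _ _ (@Num.sqrt R)); first exact: sqrt_continuous.
rewrite -(bintegral0 mu).
apply: (@bounded_cvg_bintegral _ _ _ mu _ _ ((K + L) ^+ 2)) => [n||n x|].
- exact: (bounded_measurable_normc_sq (bug n)).1.
- exact: measurable_cst.
- have ug : normc (u n x - g x) <= K + L.
    by rewrite (le_trans (le_normcD _ _))// normcN lerD.
  by rewrite ger0_norm ?sqr_ge0// ler_pXn2r ?nnegrE ?normc_ge0 ?(le_trans (normc_ge0 _) ug).
apply: filterS cu => x [l ul]; rewrite /g (climsup_ccvg ul).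
apply: cvg_of_eventually_le => e e0.
pose e' := Num.min 1 e.
have e'0 : 0 < e' by rewrite lt_min ltr01.
have e'1 : e' <= 1 by rewrite ge_min lexx.
have e'e : e' <= e by rewrite ge_min lexx orbT.
have [N0 HN] := ul _ e'0; exists N0 => k /HN uk.
rewrite subr0 ger0_norm ?sqr_ge0//; have := normc_ge0 (u k x - l).
move: (normc _) uk => a; nra.
Qed.

Lemma bounded_fun_cbounded (f : X -> R[i]^o) :
  complex_measurable f -> bounded_fun f -> cbounded_measurable f.
Proof.
(* The bound is a real element of [R[i]], valid for anything strictly above M; hence M + 1, of which
   the real part is taken. *)
move=> mf [M [Mr HM]]; split => //; exists (complex.Re (M + 1)) => x.
have : `|f x| <= M + 1 by apply: (HM _ _ x) => //; rewrite ltrDl.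
by rewrite normc_def lecE => /andP[_]; case: (f x).
Qed.

End L2.

(** The averages run over 1, ..., N and [cube_sum] over 0, ..., N - 1. The shift adds one
    application of T to f1, f2, f3 and two to f4, f5, f6, whose exponents are sums of two
    indices. *)
Lemma cube_averageE d (X : measurableType d) (R : realType) (T1 T2 T3 T4 T5 T6 : X -> X)
    (f1 f2 f3 f4 f5 f6 : X -> R[i]^o) N x :
  cube_average T1 T2 T3 T4 T5 T6 f1 f2 f3 f4 f5 f6 N x =
  cube_sum (orbit_seq T1 (f1 \o T1) x) (orbit_seq T2 (f2 \o T2) x)
    (orbit_seq T3 (f3 \o T3) x) (orbit_seq T4 (f4 \o T4 \o T4) x)
    (orbit_seq T5 (f5 \o T5 \o T5) x) (orbit_seq T6 (f6 \o T6 \o T6) x) N.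
Proof.
rewrite /cube_average /cube_sum; congr (_ * _).
rewrite big_add1 big_mkord; apply: eq_bigr => n _.
rewrite big_add1 big_mkord; apply: eq_bigr => m _.
rewrite big_add1 big_mkord; apply: eq_bigr => p _.
by rewrite /orbit_seq !addSn !addnS.
Qed.

(** Nested normalized averages, so that a bound on the terms passes through [normc_avg_le] three
    times. *)
Lemma cube_sum_avg (R : realType) (a b c A B D : nat -> R[i]) N :
  cube_sum a b c A B D N =
  N%:R^-1 * \sum_(n < N) (N%:R^-1 * \sum_(m < N) (N%:R^-1 * \sum_(p < N)
    (a n * b m * c p * A (n + m)%N * B (n + p)%N * D (m + p)%N))).
Proof.
rewrite /cube_sum 3!exprS expr0 mulr1 !invfM -!mulrA; congr (_ * _).
rewrite !mulr_sumr; apply: eq_bigr => n _.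
by rewrite -mulr_sumr; congr (_ * _).
Qed.

Lemma cube_sum_le (R : realType) (a b c A B D : nat -> R[i])
    (K1 K2 K3 K4 K5 K6 : R) N :
  (forall n, normc (a n) <= K1) -> (forall n, normc (b n) <= K2) ->
  (forall n, normc (c n) <= K3) -> (forall n, normc (A n) <= K4) ->
  (forall n, normc (B n) <= K5) -> (forall n, normc (D n) <= K6) ->
  normc (cube_sum a b c A B D N) <= K1 * K2 * K3 * K4 * K5 * K6.
Proof.
move=> H1 H2 H3 H4 H5 H6.
have pos (f : nat -> R[i]) L : (forall n, normc (f n) <= L) -> 0 <= L.
  by move=> H; exact: le_trans (normc_ge0 _) (H 0%N).
have p1 := pos _ _ H1; have p2 := pos _ _ H2; have p3 := pos _ _ H3.
have p4 := pos _ _ H4; have p5 := pos _ _ H5; have p6 := pos _ _ H6.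
have p0 : 0 <= K1 * K2 * K3 * K4 * K5 * K6 by rewrite !mulr_ge0.
rewrite cube_sum_avg.
apply: (normc_avg_le (w := fun n => N%:R^-1 * \sum_(m < N) (N%:R^-1 * \sum_(p < N)
    (a n * b m * c p * A (n + m)%N * B (n + p)%N * D (m + p)%N)))) => // n _.
apply: (normc_avg_le (w := fun m => N%:R^-1 * \sum_(p < N)
    (a n * b m * c p * A (n + m)%N * B (n + p)%N * D (m + p)%N))) => // m _.
apply: (normc_avg_le (w := fun p =>
    a n * b m * c p * A (n + m)%N * B (n + p)%N * D (m + p)%N)) => // p _.
by rewrite !Normc.normcM; repeat (apply: ler_pM; rewrite ?mulr_ge0 ?normc_ge0//).
Qed.

Lemma cbounded_measurable_cube_sum d (X : measurableType d) (R : realType)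
    (a b c A B D : X -> nat -> R[i]) N :
  (forall n, cbounded_measurable (a ^~ n)) -> (forall n, cbounded_measurable (b ^~ n)) ->
  (forall n, cbounded_measurable (c ^~ n)) -> (forall n, cbounded_measurable (A ^~ n)) ->
  (forall n, cbounded_measurable (B ^~ n)) -> (forall n, cbounded_measurable (D ^~ n)) ->
  cbounded_measurable (fun x => cube_sum (a x) (b x) (c x) (A x) (B x) (D x) N).
Proof.
move=> ba bb bc bA bB bD; apply: cbounded_measurableM; first exact: cbounded_measurable_cst.
apply: (@cbounded_measurable_sum _ _ _ N (fun n x => \sum_(m < N) \sum_(p < N)
   (a x n * b x m * c x p * A x (n + m)%N * B x (n + p)%N * D x (m + p)%N))) => n.
apply: (@cbounded_measurable_sum _ _ _ N (fun m x => \sum_(p < N)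
   (a x n * b x m * c x p * A x (n + m)%N * B x (n + p)%N * D x (m + p)%N))) => m.
apply: (@cbounded_measurable_sum _ _ _ N (fun p x =>
   a x n * b x m * c x p * A x (n + m)%N * B x (n + p)%N * D x (m + p)%N)) => p.
by do 5! (apply: cbounded_measurableM => //).
Qed.

Theorem theorem1 (R : realType) (d : measure_display) (X : measurableType d)
    (mu : {finite_measure set X -> \bar R})
    (T1 T2 T3 T4 T5 T6 : X -> X) (f1 f2 f3 f4 f5 f6 : X -> R[i]^o)
    (hT1 : measure_preserving mu T1) (hT2 : measure_preserving mu T2)
    (hT3 : measure_preserving mu T3) (hT4 : measure_preserving mu T4)
    (hT5 : measure_preserving mu T5) (hT6 : measure_preserving mu T6)
    (mf1 : complex_measurable f1) (mf2 : complex_measurable f2)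
    (mf3 : complex_measurable f3) (mf4 : complex_measurable f4)
    (mf5 : complex_measurable f5) (mf6 : complex_measurable f6)
    (bf1 : bounded_fun f1) (bf2 : bounded_fun f2) (bf3 : bounded_fun f3)
    (bf4 : bounded_fun f4) (bf5 : bounded_fun f5) (bf6 : bounded_fun f6) :
  {ae mu, forall x : X,
     cvgn (fun N : nat =>
       cube_average T1 T2 T3 T4 T5 T6 f1 f2 f3 f4 f5 f6 N x)} /\
  cvg_in_L2 mu (cube_average T1 T2 T3 T4 T5 T6 f1 f2 f3 f4 f5 f6).
Proof.
have cb (T : X -> X) (f : X -> R[i]^o) : measure_preserving mu T ->
    complex_measurable f -> bounded_fun f -> cbounded_measurable (f \o T).
  by move=> [mT _] mf bf; apply: (cbounded_measurable_comp mT); exact: bounded_fun_cbounded.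
have cb2 (T : X -> X) (f : X -> R[i]^o) : measure_preserving mu T ->
    complex_measurable f -> bounded_fun f -> cbounded_measurable (f \o T \o T).
  by move=> hT mf bf; apply: (cbounded_measurable_comp hT.1); exact: cb.
have b1 := cb _ _ hT1 mf1 bf1; have b2 := cb _ _ hT2 mf2 bf2.
have b3 := cb _ _ hT3 mf3 bf3; have b4 := cb2 _ _ hT4 mf4 bf4.
have b5 := cb2 _ _ hT5 mf5 bf5; have b6 := cb2 _ _ hT6 mf6 bf6.
pose avg := cube_average T1 T2 T3 T4 T5 T6 f1 f2 f3 f4 f5 f6.
have bseq (T : X -> X) (f : X -> R[i]) x : cbounded_measurable f -> bounded_seq (orbit_seq T f x).
  move=> [_ [K fK]]; exists K; first exact: le_trans (normc_ge0 _) (fK x).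
  by move=> n; exact: fK.
have borb (T : X -> X) (f : X -> R[i]) n : measure_preserving mu T -> cbounded_measurable f ->
    cbounded_measurable (fun x => orbit_seq T f x n).
  by move=> hT bf; exact: (cbounded_measurable_iter n hT.1 bf).
have cv : {ae mu, forall x, exists l, ccvg (avg ^~ x) l}.
  (* Almost every x gives six Wiener-Wintner sequences at once; at such an x the deterministic
     theorem applies. *)
  near=> x.
  apply: (eq_ccvg (fun N => esym (cube_averageE _ _ _ _ _ _ _ _ _ _ _ _ N x))).
  by apply: ww_cube_cvg; try exact: bseq; near: x; exact: ae_ww_sequence.
split; first by apply: filterS cv => x [l]; exact: ccvg_cvg.
(* The product of the six bounds dominates all averages, which turns almost everywhere convergence
   into convergence in norm. *)
have [K1 H1] := b1.2; have [K2 H2] := b2.2; have [K3 H3] := b3.2.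
have [K4 H4] := b4.2; have [K5 H5] := b5.2; have [K6 H6] := b6.2.
apply: (@ae_cvg_in_L2 _ _ _ mu avg (K1 * K2 * K3 * K4 * K5 * K6)) => //.
  move=> N; have -> : avg N = (fun x => cube_sum (orbit_seq T1 (f1 \o T1) x)
      (orbit_seq T2 (f2 \o T2) x) (orbit_seq T3 (f3 \o T3) x)
      (orbit_seq T4 (f4 \o T4 \o T4) x) (orbit_seq T5 (f5 \o T5 \o T5) x)
      (orbit_seq T6 (f6 \o T6 \o T6) x) N).
    by apply: funext => x; exact: cube_averageE.
  exact: (@cbounded_measurable_cube_sum _ _ _ (orbit_seq T1 _) (orbit_seq T2 _)
    (orbit_seq T3 _) (orbit_seq T4 _) (orbit_seq T5 _) (orbit_seq T6 _) N
    (fun n => borb _ _ n hT1 b1) (fun n => borb _ _ n hT2 b2)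
    (fun n => borb _ _ n hT3 b3) (fun n => borb _ _ n hT4 b4)
    (fun n => borb _ _ n hT5 b5) (fun n => borb _ _ n hT6 b6)).
by move=> N x; rewrite /avg cube_averageE; apply: cube_sum_le => n;
  [exact: H1 | exact: H2 | exact: H3 | exact: H4 | exact: H5 | exact: H6].
Unshelve. all: by end_near. Qed.
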